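(* There is an algorithm that, given a splitter network $G=(I\uplus S\uplus O,E)$ with capacities $c: I\uplus O\to[0,1]$, finds a steady-state $(t,F)$ for $(G,c)$ in time $O(|S|^2+|S|\,\mathrm{sd}(G_z))$, where $G_z$ is the graph obtained from $G$ by identifying all vertices of $I\cup O$ into a single vertex $z$, and $\mathrm{sd}(G_z)$ denotes the time needed to compute a stationary distribution (of the random walk) on any orientation of a subgraph of $G_z$.
   Context: A splitter network is a finite directed graph $G$ (loops and parallel arcs allowed) with arc set $E$ whose vertex set is partitioned as $I\uplus S\uplus O$, where each input $i\in I$ has out-degree $1$ and in-degree $0$, each output $o\in O$ has in-degree $1$ and out-degree $0$, and each splitter $s\in S$ has in-degree $2$ and out-degree $2$. For a vertex $v$, $\delta^+(v)$ and $\delta^-(v)$ denote its sets of outgoing and incoming arcs. A capacity function is a map $c:I\cup O\to[0,1]$. A steady-state for $(G,c)$ is a pair $(t,F)$ with $t:E\to[0,1]$ (throughput) and $F\subseteq E$ (fluid arcs; arcs of $E\setminus F$ are called saturated) such that: (R3) for each input $i$ with $\delta^+(i)=\{e\}$, $t(e)\le c(i)$, and if $e\in F$ then $t(e)=c(i)$; (R4) for each output $o$ with $\delta^-(o)=\{e\}$, $t(e)\le c(o)$, and if $e\notin F$ then $t(e)=c(o)$; (R5) for each splitter $s$, $\sum_{e\in\delta^-(s)}t(e)=\sum_{e\in\delta^+(s)}t(e)$; (R6) for each splitter $s$ with $\delta^-(s)=\{e_1,e_2\}$ and $e_1\notin F$, $t(e_1)\ge t(e_2)$; (R7) for each splitter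 $s$ with $\delta^+(s)=\{e_1,e_2\}$ and $e_1\in F$, $t(e_1)\ge t(e_2)$; (R8) for any arcs $uv\in E\setminus F$ and $vw\in F$, $t(uv)=1$ or $t(vw)=1$. *)

(* Defs.v *)
From mathcomp Require Import all_boot all_order all_algebra.
From mathcomp Require Import reals.

Set Implicit Arguments.
Unset Strict Implicit.
Unset Printing Implicit Defensive.

Import Order.TTheory GRing.Theory Num.Theory.
Local Open Scope ring_scope.

(** * Splitter networks and steady-states *)

Record splitter_network := SplitterNetwork {
  vertex : finType;
  arc : finType;
  src : arc -> vertex;
  tgt : arc -> vertex;
  inputs : {set vertex};
  splitters : {set vertex};
  outputs : {set vertex};
  vertex_cover : inputs :|: splitters :|: outputs = setT;
  inputs_splitters : [disjoint inputs & splitters];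
  inputs_outputs : [disjoint inputs & outputs];
  splitters_outputs : [disjoint splitters & outputs];
  input_degree : forall i, i \in inputs ->
    #|[set e | src e == i]| = 1%N /\ #|[set e | tgt e == i]| = 0%N;
  output_degree : forall o, o \in outputs ->
    #|[set e | tgt e == o]| = 1%N /\ #|[set e | src e == o]| = 0%N;
  splitter_degree : forall s, s \in splitters ->
    #|[set e | tgt e == s]| = 2%N /\ #|[set e | src e == s]| = 2%N
}.

Definition out_arcs (G : splitter_network) (v : vertex G) : {set arc G} :=
  [set e | src e == v].
Definition in_arcs (G : splitter_network) (v : vertex G) : {set arc G} :=
  [set e | tgt e == v].

(* The values of c outside I U O are irrelevant: they occur neither in the
   steady-state rules nor in the encoding of the instance in memory. *)
Definition is_capacity (R : realType) (G : splitter_network)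
    (c : vertex G -> R) : Prop :=
  forall v, v \in inputs G :|: outputs G -> 0 <= c v <= 1.

(* F is the set of fluid arcs, its complement the set of saturated arcs.  At a
   splitter, the equation with [set e1; e2] forces e1 != e2 and applies to both
   orderings of the pair. *)
Record steady_state (R : realType) (G : splitter_network) (c : vertex G -> R)
    (t : arc G -> R) (F : {set arc G}) : Prop := SteadyState {
  throughput_range : forall e, 0 <= t e <= 1;
  input_rule : forall i e, i \in inputs G -> out_arcs i = [set e] ->
    t e <= c i /\ (e \in F -> t e = c i);
  output_rule : forall o e, o \in outputs G -> in_arcs o = [set e] ->
    t e <= c o /\ (e \notin F -> t e = c o);
  splitter_conservation : forall s, s \in splitters G ->
    \sum_(e in in_arcs s) t e = \sum_(e in out_arcs s) t e;
  saturated_in_rule : forall s e1 e2, s \in splitters G -> in_arcs s = [set e1; e2] ->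
    e1 \notin F -> t e2 <= t e1;
  fluid_out_rule : forall s e1 e2, s \in splitters G -> out_arcs s = [set e1; e2] ->
    e1 \in F -> t e2 <= t e1;
  saturated_fluid_rule : forall e f, tgt e = src f -> e \notin F -> f \in F ->
    t e = 1 \/ t f = 1
}.

(** * The contracted graph G_z *)

(* Undirected multigraph: the pair of ends is read up to swapping. *)
Record multigraph := Multigraph {
  mvertex : finType;
  medge : finType;
  mends : medge -> mvertex * mvertex
}.

(* None is the vertex z. *)
Definition contract (G : splitter_network) (v : vertex G) :
    option {s : vertex G | s \in splitters G} := insub v.

Definition Gz (G : splitter_network) : multigraph :=
  @Multigraph (option {s : vertex G | s \in splitters G}) (arc G)
    (fun e => (contract (src e), contract (tgt e))).

(** * Stationary distributions *)

(* Digraph on {0, ..., order - 1}, given by its list of arcs (tail, head);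
   loops and parallel arcs are allowed. *)
Record digraph := Digraph {
  order : nat;
  darcs : seq ('I_order * 'I_order)
}.

Definition outdeg (D : digraph) (i : 'I_(order D)) : nat :=
  count (fun a => a.1 == i) (darcs D).

(* The random walk on D is defined: D has a vertex, and no sink. *)
Definition has_walk (D : digraph) : bool :=
  (0 < order D)%N && [forall i : 'I_(order D), 0 < outdeg i]%N.

Definition transition (R : realType) (D : digraph) : 'M[R]_(order D) :=
  \matrix_(i, j) ((count_mem (i, j) (darcs D))%:R / (outdeg i)%:R).

Definition stationary (R : realType) (D : digraph) (p : 'rV[R]_(order D)) :=
  [/\ forall i, 0 <= p 0 i, \sum_i p 0 i = 1 & p *m transition R D = p].

(* phi places the vertices of D in H, and es lists the edges of H of which the
   arcs of D are orientations. *)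
Definition orientation_of_subgraph (H : multigraph) (D : digraph) : bool :=
  [exists phi : {ffun 'I_(order D) -> mvertex H}, injectiveb phi &&
    [exists es : (size (darcs D)).-tuple (medge H), uniq es &&
      all2 (fun a e => (mends e == (phi a.1, phi a.2))
                    || (mends e == (phi a.2, phi a.1))) (darcs D) es]].

(* A method computing stationary distributions, with its running time.  The
   running time accounts at least for reading the digraph. *)
Record sd_method (R : realType) := SdMethod {
  sd_answer : forall D : digraph, 'rV[R]_(order D);
  sd_time : digraph -> nat;
  sd_correct : forall D, has_walk D -> stationary (sd_answer D);
  sd_reads : forall D, has_walk D -> (order D + size (darcs D) <= sd_time D)%N
}.

(* Worst-case time of the method on the orientations of subgraphs of H.  The
   bounds on n and m lose nothing, by injectivity of phi and es above. *)
Definition sd (R : realType) (M : sd_method R) (H : multigraph) : nat :=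
  \max_(n < #|mvertex H|.+1) \max_(m < #|medge H|.+1)
  \max_(a : m.-tuple ('I_n * 'I_n) |
        has_walk (@Digraph n a) && orientation_of_subgraph H (@Digraph n a))
    sd_time M (@Digraph n a).

(** * Real RAM programs *)

(* Memory consists of unbounded arrays of naturals and unbounded arrays of
   reals.  A program names arrays by constants; indices are computed. *)
Record state (R : Type) := State {
  nmem : nat -> nat -> nat;
  rmem : nat -> nat -> R
}.

Inductive nexpr :=
| NConst of nat
| NRead of nat & nexpr
| NAdd of nexpr & nexpr
| NSub of nexpr & nexpr.

Inductive rexpr :=
| RZero
| ROne
| RRead of nat & nexpr
| RAdd of rexpr & rexpr
| RSub of rexpr & rexpr
| RMul of rexpr & rexpr
| RDiv of rexpr & rexpr.

Inductive bexpr :=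
| NLe of nexpr & nexpr
| RLe of rexpr & rexpr
| BNot of bexpr
| BAnd of bexpr & bexpr.

(* NSet a i x is a[i] := x.  Stat n m tl hd r calls the method for stationary
   distributions on the digraph with n vertices and arcs (tl[k], hd[k]), k < m,
   and stores the answer in r[0], ..., r[n-1]. *)
Inductive cmd :=
| Skip
| NSet of nat & nexpr & nexpr
| RSet of nat & nexpr & rexpr
| Seq of cmd & cmd
| If of bexpr & cmd & cmd
| While of bexpr & cmd
| Stat of nexpr & nexpr & nat & nat & nat.

Fixpoint neval (R : Type) (s : state R) (e : nexpr) : nat :=
  match e with
  | NConst k => k
  | NRead a i => nmem s a (neval s i)
  | NAdd e1 e2 => neval s e1 + neval s e2
  | NSub e1 e2 => neval s e1 - neval s e2
  end%N.

Fixpoint reval (R : realType) (s : state R) (e : rexpr) : R :=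
  match e with
  | RZero => 0
  | ROne => 1
  | RRead a i => rmem s a (neval s i)
  | RAdd e1 e2 => reval s e1 + reval s e2
  | RSub e1 e2 => reval s e1 - reval s e2
  | RMul e1 e2 => reval s e1 * reval s e2
  | RDiv e1 e2 => reval s e1 / reval s e2
  end.

Fixpoint beval (R : realType) (s : state R) (b : bexpr) : bool :=
  match b with
  | NLe e1 e2 => (neval s e1 <= neval s e2)%N
  | RLe e1 e2 => reval s e1 <= reval s e2
  | BNot b1 => ~~ beval s b1
  | BAnd b1 b2 => beval s b1 && beval s b2
  end.

(* Evaluation costs one unit per constant, memory access, arithmetic operation,
   comparison or connective. *)
Fixpoint ncost (e : nexpr) : nat :=
  match e with
  | NConst _ => 1
  | NRead _ i => (ncost i).+1
  | NAdd e1 e2 | NSub e1 e2 => (ncost e1 + ncost e2).+1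
  end%N.

Fixpoint rcost (e : rexpr) : nat :=
  match e with
  | RZero | ROne => 1
  | RRead _ i => (ncost i).+1
  | RAdd e1 e2 | RSub e1 e2 | RMul e1 e2 | RDiv e1 e2 =>
      (rcost e1 + rcost e2).+1
  end%N.

Fixpoint bcost (b : bexpr) : nat :=
  match b with
  | NLe e1 e2 => (ncost e1 + ncost e2).+1
  | RLe e1 e2 => (rcost e1 + rcost e2).+1
  | BNot b1 => (bcost b1).+1
  | BAnd b1 b2 => (bcost b1 + bcost b2).+1
  end%N.

Definition upd (T : Type) (m : nat -> nat -> T) (a i : nat) (x : T) :=
  fun a' i' => if (a' == a) && (i' == i) then x else m a' i'.

Definition store_row (T : Type) (n : nat) (m : nat -> nat -> T) (a : nat)
    (p : 'rV[T]_n) :=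
  fun a' i' => if a' == a then
                 if insub i' is Some i then p 0 i else m a' i'
               else m a' i'.

(* exec M p s k s': from s, the program p halts in s' after k units of time.
   There is no rule for a call of M on something that is not a digraph on which
   the random walk is defined. *)
Inductive exec (R : realType) (M : sd_method R) :
    cmd -> state R -> nat -> state R -> Prop :=
| ExecSkip s : exec M Skip s 1 s
| ExecNSet a i e s :
    exec M (NSet a i e) s (ncost i + ncost e).+1
      (State (upd (nmem s) a (neval s i) (neval s e)) (rmem s))
| ExecRSet a i e s :
    exec M (RSet a i e) s (ncost i + rcost e).+1
      (State (nmem s) (upd (rmem s) a (neval s i) (reval s e)))
| ExecSeq p q s1 s2 s3 k1 k2 :
    exec M p s1 k1 s2 -> exec M q s2 k2 s3 ->
    exec M (Seq p q) s1 (k1 + k2) s3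
| ExecIf b p q s s' k :
    exec M (if beval s b then p else q) s k s' ->
    exec M (If b p q) s (bcost b + k) s'
| ExecWhileStop b p s :
    ~~ beval s b -> exec M (While b p) s (bcost b) s
| ExecWhileLoop b p s1 s2 s3 k1 k2 :
    beval s1 b -> exec M p s1 k1 s2 -> exec M (While b p) s2 k2 s3 ->
    exec M (While b p) s1 (bcost b + k1 + k2) s3
| ExecStat en em tl hd r s (D : digraph) :
    order D = neval s en ->
    [seq (val a.1, val a.2) | a <- darcs D]
      = [seq (nmem s tl k, nmem s hd k) | k <- iota 0 (neval s em)] ->
    has_walk D ->
    exec M (Stat en em tl hd r) s (ncost en + ncost em + sd_time M D)
      (State (nmem s) (store_row (rmem s) r (sd_answer M D))).

(** * Encoding of instances and of solutions *)

(* Vertices and arcs are numbered by their ranks in the enumerations of their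
   types, which are arbitrary. *)
Definition vertex_kind (G : splitter_network) (v : vertex G) : nat :=
  if v \in inputs G then 0%N else if v \in splitters G then 1%N else 2%N.

(* Natural arrays 0 to 3: the numbers of vertices and of arcs, the sources, the
   targets, the kinds of the vertices.  Real array 0: the capacities.  All the
   other cells are zero. *)
Definition initial_state (R : realType) (G : splitter_network)
    (c : vertex G -> R) : state R :=
  State
    (fun a k => nth 0%N (match a with
       | 0 => [:: #|vertex G|; #|arc G|]
       | 1 => [seq (enum_rank (src e) : nat) | e <- enum (arc G)]
       | 2 => [seq (enum_rank (tgt e) : nat) | e <- enum (arc G)]
       | 3 => [seq vertex_kind v | v <- enum (vertex G)]
       | _ => [::]
       end%N) k)
    (fun a k => if a == 0%N then
       nth 0 [seq if v \in inputs G :|: outputs G then c v else 0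
             | v <- enum (vertex G)] k
       else 0).

(* Natural array 4: the fluid arcs, as a 0/1 vector.  Real array 1: the
   throughputs. *)
Definition result_throughput (R : realType) (G : splitter_network)
    (s : state R) : arc G -> R := fun e => rmem s 1 (enum_rank e).

Definition result_fluid (R : realType) (G : splitter_network)
    (s : state R) : {set arc G} := [set e | nmem s 4 (enum_rank e) == 1%N].

(* Main.v *)
(* Contract the inputs and outputs to one vertex z, and start from t = 0 with
   all arcs fluid.  All rules hold but one: a fluid input arc should carry the
   whole capacity of its input.  Fluid arcs only ever become saturated: those
   that are full, and, at a splitter without fluid out-arcs, those entering
   with maximal throughput.  When no arc has to be saturated, orient fluid arcs
   forward and saturated arcs entering splitters without fluid out-arcs
   backward.  A stationary distribution of the walk on this orientation is a
   circulation that gives equal amounts to the arcs leaving a vertex, so adding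
   it to t on forward arcs and subtracting it on backward arcs respects all
   rules, up to a step length at which an arc must become saturated, an input
   is exhausted, or a backward arc is emptied.  Each of these happens O(1)
   times per arc at a splitter, hence O(|S|) times in all, and a round costs
   O(|E|) besides the call to the method.  Reading G_z itself already takes
   the method time |E|. *)
Require Import Defs.
From mathcomp Require Import all_boot all_order all_algebra.
From mathcomp Require Import reals.
From mathcomp Require boolp.
From mathcomp Require Import zify lra.

Set Implicit Arguments.
Unset Strict Implicit.
Unset Printing Implicit Defensive.

(* [arc] and [order] also name constants of MathComp. *)
Import Defs.
Import Order.TTheory GRing.Theory Num.Theory.
Local Open Scope ring_scope.

(** * Relaxed steady-states *)

(** The walk must have no sink, and this is what [settled] provides. At a blocked splitter a fluid
    entering arc carries strictly less than its sibling; the sibling is then saturated and nonempty,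
    so it can be traversed backward. At an unblocked splitter some fluid leaving arc is below 1. The
    same bound protects [rel_saturated_fluid]: a saturated arc followed by a fluid one already
    carries 1, and it keeps that value because it is not a move. Termination needs care because a
    push may end at a mere tie, which changes no arc status. A round therefore either saturates or
    pushes. Saturating trades weight 2 for at most 1 in [potential]; a push that leaves [potential]
    unchanged makes some arc saturable, which the bit [settled] in [measure] records. Arcs from
    inputs to outputs are not counted by the splitters. They get final values at the start and are
    kept out of the potential; [rel_direct] guarantees that no round touches them. *)

Section Relaxed.

(* The contracted graph: [z] stands for the inputs and the outputs, and the
   capacities of an arc are 1 at its ends other than [z]. *)
Variables (R : realFieldType) (A W : finType) (z : W) (zs zt : A -> W).
Variables icap ocap : A -> R.

Hypothesis icap_range : forall e, 0 <= icap e <= 1.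
Hypothesis ocap_range : forall e, 0 <= ocap e <= 1.
Hypothesis icap_splitter : forall e, zs e != z -> icap e = 1.
Hypothesis ocap_splitter : forall e, zt e != z -> ocap e = 1.
Hypothesis in_degree : forall w, w != z -> #|[set e | zt e == w]| = 2%N.

Implicit Types (t x : A -> R) (F : {set A}) (e f : A) (w : W).

(* Everything but the rule that a fluid input arc carries the whole capacity
   of its input; the last clause settles the arcs from inputs to outputs. *)
Record relaxed t F : Prop := Relaxed {
  rel_ge0 : forall e, 0 <= t e;
  rel_icap : forall e, t e <= icap e;
  rel_ocap : forall e, t e <= ocap e;
  rel_output : forall e, zt e = z -> e \notin F -> t e = ocap e;
  rel_conserve : forall w, w != z ->
    \sum_(e | zt e == w) t e = \sum_(e | zs e == w) t e;
  rel_saturated_in : forall e f, zt e = zt f -> zt e != z -> e \notin F ->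
    t f <= t e;
  rel_fluid_out : forall e f, zs e = zs f -> zs e != z -> e \in F ->
    t f <= t e;
  rel_saturated_fluid : forall e f, zt e = zs f -> zt e != z ->
    e \notin F -> f \in F -> t e = 1 \/ t f = 1;
  rel_direct : forall e, zs e = z -> zt e = z -> e \in F ->
    t e = icap e /\ icap e < ocap e
}.

Definition blocked F w := [forall e, (e \in F) ==> (zs e != w)].
Definition insum x w := \sum_(e | zt e == w) x e.
(** At a splitter the last test says that the sibling of [e] carries at most [t e]; it uses [insum]
    because the program has that sum at hand. A blocked head leaves no fluid successor for which
    [rel_saturated_fluid] could fail. *)
Definition saturable t F e :=
  (e \in F) && ((ocap e <= t e) ||
                blocked F (zt e) && (insum t (zt e) <= t e + t e)).
Definition saturate t F := [set e in F | ~~ saturable t F e].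
Definition settled t F := [forall e, ~~ saturable t F e].
Definition active t F e := (e \in F) && (t e < icap e).
Definition has_source t F := [exists e, (zs e == z) && active t F e].

(** Only room at the tail is tested for a fluid arc; room at its head, [t e < ocap e], comes from
    [settled]. *)
Definition moves t F e :=
  if e \in F then t e < icap e else blocked F (zt e) && (0 < t e).
Definition mtail F e := if e \in F then zs e else zt e.
Definition mhead F e := if e \in F then zt e else zs e.

Definition direct e := (zs e == z) && (zt e == z).
Definition potential t F : nat :=
  (\sum_(e | ~~ direct e) (2 * (e \in F) + ((e \in F) && (t e < icap e)%R)
                           + ((e \notin F) && (0 < t e)%R)))%N.
(** The factor 2 pays for the bit: a saturation lowers the potential by at least 1 and may raise
    [settled] from 0 to 1. *)
Definition measure t F : nat := (2 * potential t F + settled t F)%N.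

Definition initial_t e := if direct e then Num.min (icap e) (ocap e) else 0.
Definition initial_F := [set e | direct e ==> (icap e < ocap e)].

Lemma initial_relaxed : relaxed initial_t initial_F.
Proof.
have nd e : zt e != z -> direct e = false by rewrite /direct andbC => /negPf->.
have nd' e : zs e != z -> direct e = false by rewrite /direct => /negPf->.
have min0 e : 0 <= initial_t e.
  rewrite /initial_t; case: ifP => // _; rewrite le_min.
  by case/andP: (icap_range e) => -> _; case/andP: (ocap_range e) => -> _.
split=> //.
- move=> e; rewrite /initial_t; case: ifP => _; first by rewrite ge_min lexx.
  by case/andP: (icap_range e).
- move=> e; rewrite /initial_t; case: ifP => _; first by rewrite ge_min lexx orbT.
  by case/andP: (ocap_range e).
- move=> e _; rewrite inE negb_imply -leNgt /initial_t => /andP[-> h].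
  exact: min_r.
- move=> w nz; rewrite !big1 // => e /eqP ew; rewrite /initial_t.
    by rewrite nd' ?ew.
  by rewrite nd ?ew.
- by move=> e f _ /nd h; rewrite inE h.
- by move=> e f ef nz _; rewrite {1}/initial_t nd' // -ef.
- by move=> e f _ /nd h; rewrite inE h.
- move=> e e1 e2; have d : direct e by rewrite /direct e1 e2 !eqxx.
  by rewrite inE /initial_t d /= => h; rewrite min_l // ltW.
Qed.

(** An arc contributes at most [2 + 1] to the potential, which is doubled; the final 1 is the bit
    [settled]. *)
Lemma measure_le t F N : (#|[set e | ~~ direct e]| <= N)%N ->
  (measure t F <= 6 * N + 1)%N.
Proof.
move=> dN; rewrite /measure leq_add ?leq_b1 //.
have : (potential t F <= \sum_(e | ~~ direct e) 3)%N.
  apply: leq_sum => e _; case: (e \in F) => /=; first by case: (t e < icap e).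
  by case: (0 < t e).
by rewrite sum_nat_cond_const; lia.
Qed.

Lemma sibling_in e : zt e != z ->
  exists f, [/\ zt f = zt e, f != e,
    forall g, zt g = zt e -> g = e \/ g = f &
    forall x, insum x (zt e) = x e + x f].
Proof.
move=> nz; have /eqP/cards2P[a [b [ab Eab]]] := in_degree nz.
have M g : (zt g == zt e) = (g \in [set a; b]) by rewrite -Eab inE.
have S x : insum x (zt e) = x a + x b.
  by rewrite /insum (eq_bigl _ _ M) big_setU1 ?inE //= big_set1.
have := M e; rewrite eqxx !inE => /esym/orP[] /eqP E; subst.
- exists b; split => //; first by apply/eqP; rewrite M !inE eqxx orbT.
    by rewrite eq_sym.
  by move=> g /eqP; rewrite M !inE => /orP[] /eqP; [left|right].
- exists a; split => //; first by apply/eqP; rewrite M !inE eqxx.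
    by move=> g /eqP; rewrite M !inE => /orP[] /eqP; [right|left].
  by move=> x; rewrite S addrC.
Qed.

Lemma blockedPn F w : reflect (exists2 e, e \in F & zs e = w) (~~ blocked F w).
Proof.
apply: (iffP forallPn) => [[e]|[e eF <-]].
  by rewrite negb_imply negbK => /andP[eF /eqP]; exists e.
by exists e; rewrite eF /= eqxx.
Qed.

Lemma rel_le1 t F e : relaxed t F -> t e <= 1.
Proof. by move=> r; apply: le_trans (rel_icap r e) _; case/andP: (icap_range e). Qed.

Lemma source_unblocked t F : has_source t F -> ~~ blocked F z.
Proof.
by case/existsP => e /andP[/eqP ez /andP[eF _]]; apply/blockedPn; exists e.
Qed.

(** Since [F] only shrinks, the rules on saturated arcs are the ones at stake. A full arc into a
    splitter carries 1, which dominates its sibling and settles [rel_saturated_fluid]; an arc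
    saturated at a blocked splitter dominates its sibling by the test and has no fluid successor. As
    [z] is unblocked, an output arc is saturated only when full. *)
Lemma saturate_relaxed t F :
  relaxed t F -> ~~ blocked F z -> relaxed t (saturate t F).
Proof.
move=> r nb.
have sF : saturate t F \subset F by apply/subsetP => e; rewrite inE => /andP[].
have sat e : e \notin saturate t F -> e \in F -> saturable t F e.
  by rewrite inE => + eF; rewrite eF negbK.
split; try exact: r.
- by apply: rel_ge0 r.
- by apply: rel_icap r.
- by apply: rel_ocap r.
- move=> e ez es; case: (boolP (e \in F)) => eF; last exact: (rel_output r).
  have /andP[_] := sat _ es eF; rewrite ez (negPf nb) /= orbF => h.
  by apply/eqP; rewrite eq_le h (rel_ocap r).
- by apply: rel_conserve r.
- move=> e f ef nz es; case: (boolP (e \in F)) => eF; last exact: (rel_saturated_in r ef).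
  have /andP[_ /orP[|/andP[_]]] := sat _ es eF.
    by rewrite ocap_splitter //; apply: le_trans (rel_le1 _ r).
  have [g [_ _ G S]] := sibling_in nz; rewrite S => h.
  by case: (G f) => // ->; lra.
- by move=> e f ef nz /(subsetP sF); apply: (rel_fluid_out r).
- move=> e f ef nz es /[dup] fs /(subsetP sF) fF.
  case: (boolP (e \in F)) => eF; last exact: (rel_saturated_fluid r ef nz).
  have /andP[_ /orP[|/andP[+ _]]] := sat _ es eF.
    by rewrite ocap_splitter // => h; left; apply/eqP; rewrite eq_le h (rel_le1 _ r).
  by move/forallP/(_ f); rewrite fF ef eqxx.
- by move=> e ez1 ez2 /(subsetP sF); apply: (rel_direct r).
Qed.

Lemma potential_saturate t F : relaxed t F -> ~~ blocked F z ->
  ~~ settled t F -> (potential t (saturate t F) < potential t F)%N.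
Proof.
move=> r nb /forallPn[e]; rewrite negbK => se.
have eF : e \in F by case/andP: se.
(* A fluid direct arc has [t e = icap e < ocap e] and the unblocked head [z], so it is not
   saturable. *)
have ne : ~~ direct e.
  apply/negP => /andP[/eqP e1 /eqP e2]; case/andP: se => _.
  have [h1 h2] := rel_direct r e1 e2 eF.
  by rewrite h1 leNgt h2 /= e2 (negPf nb).
rewrite /potential (bigD1 e) //= [ltnRHS](bigD1 e) //= -addSn.
apply: leq_add.
  by rewrite inE eF se /=; case: (0 < t e); case: (t e < icap e).
apply: leq_sum => f _; rewrite inE; case: (f \in F) => //=.
by case: (saturable t F f); case: (0 < t f); case: (t f < icap f).
Qed.

Section Settled.

Variables (t : A -> R) (F : {set A}).
Hypothesis rel : relaxed t F.
Hypothesis stl : settled t F.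
Hypothesis src : has_source t F.

Lemma settled_ocap e : e \in F -> t e < ocap e.
Proof.
move=> eF; have /forallP/(_ e) := stl.
by rewrite /saturable eF negb_or -ltNge => /andP[].
Qed.

(** At a splitter this says that the sibling carries strictly more, so two fluid siblings cannot
    enter a blocked splitter. *)
Lemma settled_blocked e : e \in F -> blocked F (zt e) ->
  t e + t e < insum t (zt e).
Proof.
move=> eF b; have /forallP/(_ e) := stl.
by rewrite /saturable eF negb_or b ltNge => /andP[].
Qed.

Lemma settled_lt1 e : e \in F -> t e < 1.
Proof.
move=> eF; apply: lt_le_trans (settled_ocap eF) _.
by case/andP: (ocap_range e).
Qed.

Lemma moves_fluid e : e \in F -> zs e != z -> moves t F e.
Proof. by move=> eF nz; rewrite /moves eF icap_splitter // settled_lt1. Qed.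

Lemma unblocked_moves w : ~~ blocked F w ->
  exists2 f, moves t F f & mtail F f = w.
Proof.
move=> nb; have [->|nz] := eqVneq w z.
  case/existsP: src => e /andP[/eqP ez /andP[eF ti]].
  by exists e; rewrite /moves /mtail eF.
case/blockedPn: nb => e eF ew; exists e; last by rewrite /mtail eF.
by apply: moves_fluid; rewrite ?ew.
Qed.

(** A saturated [e] itself runs backward out of [w]. A fluid [e] has a sibling that carries more and
    is therefore saturated, and the sibling runs backward. *)
Lemma blocked_moves w e : blocked F w -> zt e = w -> 0 < t e ->
  exists2 f, moves t F f & mtail F f = w.
Proof.
move=> b ew t0; subst w.
have nz : zt e != z by apply: contraNneq (source_unblocked src) => <-.
have [g [gw ge G S]] := sibling_in nz.
case: (boolP (e \in F)) => eF; last first.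
  by exists e; rewrite /moves /mtail (negPf eF) ?b.
have := settled_blocked eF b; rewrite S => lt.
case: (boolP (g \in F)) => gF; last first.
  by exists g; rewrite /moves /mtail (negPf gF) ?gw ?b //=; lra.
by have := settled_blocked gF; rewrite gw S => /(_ b); lra.
Qed.

(** The orientation has no sink. If the head is blocked, some arc with positive throughput enters
    it: for a backward move, conservation turns the outflow [t e > 0] into inflow; for a forward
    move, the sibling carries more than [t e >= 0]. *)
Lemma moves_head e : moves t F e ->
  exists2 f, moves t F f & mtail F f = mhead F e.
Proof.
move=> me; case: (boolP (blocked F (mhead F e))) => b; last exact: unblocked_moves.
move: me b; rewrite /moves /mhead; case: ifP => eF; last first.
  case/andP => be t0 b.
  have nz : zs e != z by apply: contraNneq (source_unblocked src) => <-.
  have : 0 < insum t (zs e).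
    rewrite /insum (rel_conserve rel) // (bigD1 e) //=.
    by apply: ltr_wpDr => //; apply: sumr_ge0 => ? _; apply: (rel_ge0 rel).
  rewrite lt_def => /andP[+ _].
  rewrite psumr_neq0; last by move=> ? _; apply: (rel_ge0 rel).
  by case/hasP => f _ /andP[/eqP fe tf]; apply: (blocked_moves b fe).
move=> _ b.
have nz : zt e != z by apply: contraNneq (source_unblocked src) => <-.
have [g [gw ge G S]] := sibling_in nz.
have := settled_blocked eF b; rewrite S => lt.
by apply: (blocked_moves b gw); have := rel_ge0 rel e; lra.
Qed.

(** * Pushing along a circulation of the orientation *)

Variable x : A -> R.
Hypothesis x_ge0 : forall e, 0 <= x e.
Hypothesis x_moves : forall e, ~~ moves t F e -> x e = 0.
Hypothesis x_tail : forall e f, moves t F e -> moves t F f ->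
  mtail F e = mtail F f -> x e = x f.
Hypothesis x_conserve : forall w,
  \sum_(e | mtail F e == w) x e = \sum_(e | mhead F e == w) x e.

(* Pairs (slack, rate): the step length times the rate is at most the slack. *)
Definition constraints e : seq (R * R) :=
  if e \in F then
    [:: (ocap e - t e, x e); (icap e - t e, x e)] ++
    (if blocked F (zt e)
     then [:: (insum t (zt e) - (t e + t e), insum x (zt e))] else [::])
  else [:: (t e, x e)].

Definition push l e := if e \in F then t e + l * x e else t e - l * x e.

(** Strict slack is what makes the step length positive; it comes from [settled] and from the strict
    inequalities in [moves]. *)
Lemma constraint_slack e p : p \in constraints e -> 0 < p.2 -> 0 < p.1.
Proof.
rewrite /constraints; case: ifPn => eF.
  rewrite mem_cat !inE -orbA => /or3P[/eqP->|/eqP->|] /=.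
  - by rewrite subr_gt0 settled_ocap.
  - case: (boolP (moves t F e)) => [|/x_moves->]; last by rewrite ltxx.
    by rewrite /moves eF subr_gt0.
  by case: ifP => // b; rewrite inE => /eqP-> /=; rewrite subr_gt0 settled_blocked.
rewrite inE => /eqP-> /=.
case: (boolP (moves t F e)) => [|/x_moves->]; last by rewrite ltxx.
by rewrite /moves (negPf eF) => /andP[].
Qed.

Lemma constraint_ge0 e p : p \in constraints e -> 0 <= p.1 /\ 0 <= p.2.
Proof.
rewrite /constraints; case: ifPn => eF.
  rewrite mem_cat !inE -orbA => /or3P[/eqP->|/eqP->|] /=; rewrite ?subr_ge0.
  - by rewrite x_ge0 (rel_ocap rel).
  - by rewrite x_ge0 (rel_icap rel).
  case: ifP => // b; rewrite inE => /eqP-> /=; rewrite subr_ge0.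
  by split; [apply: ltW; exact: settled_blocked | exact: sumr_ge0].
by rewrite inE => /eqP-> /=; rewrite x_ge0 (rel_ge0 rel).
Qed.

Lemma constraint_exists e : 0 < x e ->
  exists2 p, p \in constraints e & 0 < p.2.
Proof.
move=> xe; rewrite /constraints; case: ifP => _.
  by exists (ocap e - t e, x e); rewrite ?inE ?eqxx.
by exists (t e, x e); rewrite ?inE ?eqxx.
Qed.

Variable l : R.
Hypothesis l_gt0 : 0 < l.
Hypothesis l_le : forall e p, p \in constraints e -> 0 < p.2 -> l * p.2 <= p.1.

Let l_le0 e p : p \in constraints e -> l * p.2 <= p.1.
Proof.
move=> pe; have [p1 p2] := constraint_ge0 pe.
move: p2; rewrite le_eqVlt => /orP[/eqP<-|]; first by rewrite mulr0.
exact: l_le pe.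
Qed.

Let push_ocap e : e \in F -> l * x e <= ocap e - t e.
Proof.
move=> eF; apply: (@l_le0 e (_, _)).
by rewrite /constraints eF mem_cat !inE eqxx.
Qed.

Let push_icap e : e \in F -> l * x e <= icap e - t e.
Proof.
move=> eF; apply: (@l_le0 e (_, _)).
by rewrite /constraints eF mem_cat !inE eqxx orbT.
Qed.

Let push_blocked e : e \in F -> blocked F (zt e) ->
  l * insum x (zt e) <= insum t (zt e) - (t e + t e).
Proof.
move=> eF b; apply: (@l_le0 e (_, _)).
by rewrite /constraints eF b mem_cat !inE eqxx !orbT.
Qed.

Let push_pos e : e \notin F -> l * x e <= t e.
Proof.
move=> eF; apply: (@l_le0 e (_, _)).
by rewrite /constraints (negPf eF) !inE eqxx.
Qed.

Let lx_ge0 e : 0 <= l * x e.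
Proof. by rewrite mulr_ge0 // ltW. Qed.

Lemma push_still e : ~~ moves t F e -> push l e = t e.
Proof. by move=> m; rewrite /push x_moves // mulr0 addr0 subr0 if_same. Qed.

Lemma push_unblocked e : e \notin F -> ~~ blocked F (zt e) -> push l e = t e.
Proof. by move=> eF b; apply: push_still; rewrite /moves (negPf eF) (negPf b). Qed.

(** Splitting each sum into fluid and saturated arcs and moving the backward terms across turns
    conservation of [x] on the orientation into conservation of the signed change on the original
    arcs. *)
Lemma push_conserve w : w != z ->
  \sum_(e | zt e == w) push l e = \sum_(e | zs e == w) push l e.
Proof.
move=> nz; have := x_conserve w.
have sp (g h : A -> W) :
  \sum_(e | (if e \in F then g e else h e) == w) x e =
  \sum_(e | (g e == w) && (e \in F)) x e + \sum_(e | (h e == w) && (e \notin F)) x e.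
  rewrite (bigID [in F]) /=; congr +%R; apply: eq_bigl => e.
    by case: (e \in F); rewrite ?andbF.
  by case: (e \in F); rewrite ?andbF.
rewrite /mtail /mhead !sp.
have pu (g : A -> W) : \sum_(e | g e == w) push l e =
  \sum_(e | g e == w) t e + l * (\sum_(e | (g e == w) && (e \in F)) x e -
  \sum_(e | (g e == w) && (e \notin F)) x e).
  rewrite (bigID [in F]) /= [in RHS](bigID [in F]) /= mulrBr !mulr_sumr.
  rewrite addrACA -sumrN -!big_split /=; congr +%R; apply: eq_bigr => e /andP[_].
    by rewrite /push => ->.
  by rewrite /push => /negPf->.
by rewrite !pu (rel_conserve rel) // => h; congr (_ + l * _); lra.
Qed.

Lemma push_relaxed : relaxed (push l) F.
Proof.
have nbz := source_unblocked src.
split.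
- move=> e; rewrite /push; case: ifPn => eF; last by rewrite subr_ge0 push_pos.
  by rewrite addr_ge0 ?(rel_ge0 rel).
- move=> e; rewrite /push; case: ifPn => eF; first by have := push_icap eF; lra.
  by have := rel_icap rel e; have := lx_ge0 e; lra.
- move=> e; rewrite /push; case: ifPn => eF; first by have := push_ocap eF; lra.
  by have := rel_ocap rel e; have := lx_ge0 e; lra.
- by move=> e ez eF; rewrite push_unblocked ?ez // (rel_output rel).
- exact: push_conserve.
- move=> e f ef nz eF; case: (boolP (blocked F (zt e))) => b; last first.
    case: (boolP (f \in F)) => fF; last first.
      by rewrite !push_unblocked -?ef // (rel_saturated_in rel ef).
    rewrite (push_unblocked eF b).
    case/blockedPn: (b) => g gF gw.
    (* The fluid arc [g] is below 1, so [t e = 1], and a sibling bounded by [ocap] cannot exceed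
       it. *)
    have [|->|t1] := rel_saturated_fluid rel _ nz eF gF; first by [].
      rewrite /push fF; have := push_ocap fF.
      by have /andP[_] := ocap_range f; lra.
    by have := settled_lt1 gF; rewrite t1 ltxx.
  have [->//|nef] := eqVneq f e.
  have [g [gw ge G S]] := sibling_in nz.
  have {G} ?: g = f by case: (G f) => // fe; rewrite fe eqxx in nef.
  subst g; case: (boolP (f \in F)) => fF.
    (* While [f] gains, the saturated [e] loses, so their gap closes at rate [x e + x f], which is
       [insum x]. *)
    have := push_blocked fF; rewrite gw !S => /(_ b).
    by rewrite /push fF (negPf eF) mulrDr; lra.
  (* Saturated siblings carry the same amount, so both run backward or neither does, and [x_tail]
     keeps them equal. *)
  have E : t e = t f.
    by apply/eqP; rewrite eq_le !(rel_saturated_in rel) // gw.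
  suff Ex : x e = x f by rewrite /push (negPf eF) (negPf fF) E Ex.
  have := rel_ge0 rel e; rewrite le_eqVlt => /orP[/eqP t0|t0].
    rewrite !x_moves // /moves ?(negPf eF) ?(negPf fF) -?E -?t0 ltxx andbF //.
  by apply: x_tail; rewrite /moves /mtail ?(negPf eF) ?(negPf fF) ?gw ?b -?E.
- move=> e f ef nz eF; rewrite /push eF; case: ifPn => fF.
    have -> : t e = t f.
      by apply/eqP; rewrite eq_le !(rel_fluid_out rel) // -ef.
    have -> // : x e = x f.
    by apply: x_tail; rewrite ?moves_fluid -?ef // /mtail eF fF.
  have := rel_fluid_out rel ef nz eF.
  by have := lx_ge0 e; have := lx_ge0 f; lra.
- move=> e f ef nz eF fF; have nb : ~~ blocked F (zt e) by apply/blockedPn; exists f.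
  rewrite (push_unblocked eF nb).
  have [t1|t1] := rel_saturated_fluid rel ef nz eF fF; first by left.
  by have := settled_lt1 fF; rewrite t1 ltxx.
- move=> e e1 e2 eF; have [h1 h2] := rel_direct rel e1 e2 eF.
  by rewrite push_still // /moves eF h1 ltxx.
Qed.

(** Fluid arcs gain and saturated arcs lose, so activity and positivity can only disappear. *)
Lemma potential_push : (potential (push l) F <= potential t F)%N.
Proof.
apply: leq_sum => e _; rewrite /push; case: (boolP (e \in F)) => eF /=.
  rewrite leq_add2r leq_add2l; case: (boolP (t e < icap e)) => //= h.
    exact: leq_b1.
  by have := lx_ge0 e; rewrite leqn0 eqb0 -leNgt; move: h; rewrite -leNgt; lra.
rewrite leq_add2l; case: (boolP (0 < t e)) => //= h; first exact: leq_b1.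
by have := lx_ge0 e; rewrite leqn0 eqb0 -leNgt; move: h; rewrite -leNgt; lra.
Qed.

(* A tight constraint makes a fluid arc saturable, or lowers the potential. *)
Lemma measure_push e p : p \in constraints e -> 0 < p.2 -> l * p.2 = p.1 ->
  (measure (push l) F < measure t F)%N.
Proof.
move=> pe p2 lp.
suff : ~~ settled (push l) F \/ (potential (push l) F < potential t F)%N.
  rewrite /measure stl => -[h|h]; last first.
    by rewrite (leq_ltn_trans (leq_add (leqnn _) (leq_b1 _))) //; lia.
  by have := potential_push; rewrite (negPf h); lia.
have drop : ~~ direct e ->
    (2 * (e \in F) + ((e \in F) && (push l e < icap e)%R)
                           + ((e \notin F) && (0 < push l e)%R) <
    2 * (e \in F) + ((e \in F) && (t e < icap e)%R)
                           + ((e \notin F) && (0 < t e)%R))%N ->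
    (potential (push l) F < potential t F)%N.
  move=> nd h; rewrite /potential (bigD1 e) //= [ltnRHS](bigD1 e) //= -addSn.
  apply: leq_add => //; apply: leq_sum => f _.
  rewrite /push; case: (boolP (f \in F)) => fF /=.
    rewrite leq_add2r leq_add2l; case: (boolP (t f < icap f)) => //= hf.
      exact: leq_b1.
    by have := lx_ge0 f; rewrite leqn0 eqb0 -leNgt; move: hf; rewrite -leNgt; lra.
  rewrite leq_add2l; case: (boolP (0 < t f)) => //= hf; first exact: leq_b1.
  by have := lx_ge0 f; rewrite leqn0 eqb0 -leNgt; move: hf; rewrite -leNgt; lra.
move: pe; rewrite /constraints; case: ifPn => eF.
  rewrite mem_cat !inE -orbA => /or3P[/eqP E|/eqP E|]; try subst p; simpl in *.
  - left; apply/forallPn; exists e; rewrite negbK /saturable eF /push eF.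
    by apply/orP; left; rewrite lp; lra.
  - right; apply: drop; last first.
      have : moves t F e by apply: contraTT p2 => /x_moves->; rewrite ltxx.
      rewrite eF /moves eF /push eF lp => ->.
      by rewrite addrC subrK ltxx.
    (* Direct arcs do not move, so a tight constraint of positive rate sits on an arc that the
       potential counts. *)
    apply: contraTN p2 => /andP[/eqP e1 /eqP e2].
    have [h1 h2] := rel_direct rel e1 e2 eF.
    by rewrite x_moves ?ltxx // /moves eF h1 ltxx.
  case: ifP => // b; rewrite inE => /eqP E; subst p; simpl in *.
  left; apply/forallPn; exists e; rewrite negbK /saturable eF b /=.
  apply/orP; right.
  have nz : zt e != z by apply: contraNneq (source_unblocked src) => <-.
  have [g [gw ge G S]] := sibling_in nz; rewrite !S in lp *.
  have gF : g \notin F.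
    apply/negP => gF; have := settled_blocked eF b; have := settled_blocked gF.
    by rewrite gw S => /(_ b); lra.
  by rewrite /push eF (negPf gF); lra.
rewrite inE => /eqP E; subst p; simpl in *.
have : moves t F e by apply: contraTT p2 => /x_moves->; rewrite ltxx.
rewrite /moves (negPf eF) => /andP[b t0].
right; apply: drop.
  apply: contraNN (source_unblocked src) => /andP[_ /eqP <-]; exact: b.
by rewrite (negPf eF) /push (negPf eF) lp subrr ltxx t0.
Qed.

End Settled.

End Relaxed.

(* A negative [l] stands for "no constraint met so far". *)
Definition min_step (R : realFieldType) (l : R) (p : R * R) : R :=
  if (0 < p.2) && ((l < 0) || (p.1 / p.2 < l)) then p.1 / p.2 else l.

(** All relevant ratios are positive, so the sign of the accumulator tells whether a constraint was
    met. The induction on prefixes keeps both cases; the pair of positive rate excludes the start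
    value at the end. *)
Lemma foldl_min_step (R : realFieldType) (L : seq (R * R)) :
  (forall p, p \in L -> 0 < p.2 -> 0 < p.1) ->
  (exists2 p, p \in L & 0 < p.2) ->
  let l := foldl (@min_step R) (- 1) L in
  [/\ 0 < l, forall p, p \in L -> 0 < p.2 -> l * p.2 <= p.1 &
      exists p, [/\ p \in L, 0 < p.2 & l * p.2 = p.1]].
Proof.
move=> pos ex /=; set l := foldl _ _ _.
have inv : (l = -1 /\ forall p, p \in L -> ~~ (0 < p.2)) \/
    [/\ 0 < l, forall p, p \in L -> 0 < p.2 -> l * p.2 <= p.1 &
      exists p, [/\ p \in L, 0 < p.2 & l * p.2 = p.1]].
  rewrite {}/l {ex}; elim/last_ind: L pos => [|L q IH] pos; first by left.
  rewrite -cats1 foldl_cat /=.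
  have {IH} IH := IH (fun p pL => pos p (etrans (mem_rcons _ _ _) (predU1r _ _ pL))).
  have qpos : 0 < q.2 -> 0 < q.1 by apply: pos; rewrite mem_rcons mem_head.
  have mem p : p \in L ++ [:: q] -> p = q \/ p \in L.
    by rewrite mem_cat inE orbC => /orP[/eqP|]; [left|right].
  set l := foldl _ _ _ in IH *.
  rewrite /min_step; case: (boolP (0 < q.2)) => q2 /=; last first.
    case: IH => [[-> N]|[l0 le [p [pL p2 E]]]]; [left|right].
      by split=> // p /mem[->//|/N].
    split=> //; first by move=> r /mem[-> r2|]; [rewrite r2 in q2 | exact: le].
    by exists p; rewrite mem_cat pL.
  have q1 := qpos q2; right.
  have qE : q.1 / q.2 * q.2 = q.1 by rewrite divfK // gt_eqF.
  have q0 : 0 < q.1 / q.2 by rewrite divr_gt0.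
  case: IH => [[-> N]|[l0 le [p [pL p2 E]]]].
    rewrite ltrN10 /=; split=> //.
      by move=> r /mem[->|/N/negPf->]; rewrite ?qE.
    by exists q; rewrite mem_cat mem_head orbT.
  rewrite (le_gtF (ltW l0)) /=; case: (ltrP (q.1 / q.2) l) => lq; split=> //.
  - move=> r /mem[->|rL r2]; first by rewrite qE.
    by apply: le_trans (le r rL r2); rewrite ler_pM2r // ltW.
  - by exists q; rewrite mem_cat mem_head orbT.
  - move=> r /mem[-> _|]; last exact: le.
    by rewrite -ler_pdivlMr.
  - by exists p; rewrite mem_cat pL.
case: inv => // -[_ N]; case: ex => p pL p2.
by have := N p pL; rewrite p2.
Qed.

(** * Random walks on orientations of subgraphs *)

Section Walk.

Variables (R : realType) (M : sd_method R) (H : multigraph).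
Variables (es : seq (medge H)) (tl hd : medge H -> mvertex H).
Variables (n : nat) (num : mvertex H -> nat).

Hypothesis es_uniq : uniq es.
Hypothesis es_ends : forall e,
  (mends e == (tl e, hd e)) || (mends e == (hd e, tl e)).
Hypothesis es_closed : forall e, e \in es -> exists2 f, f \in es & tl f = hd e.
Hypothesis num_lt : forall e, e \in es -> (num (tl e) < n.+1)%N.
Hypothesis num_inj : forall e f, e \in es -> f \in es ->
  num (tl e) = num (tl f) -> tl e = tl f.
Hypothesis num_surj : forall k, (k < n.+1)%N ->
  exists2 e, e \in es & num (tl e) = k.

Let ti e : 'I_n.+1 := inord (num (tl e)).
Let hi e : 'I_n.+1 := inord (num (hd e)).
(** The vertices are exactly the tails, numbered without gaps: with isolated vertices or sinks the
    walk would be undefined. The form [n.+1] gives access to [inord]. *)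
Let D := @Digraph n.+1 [seq (ti e, hi e) | e <- es].

Let ti_inj e f : e \in es -> f \in es -> (ti e == ti f) = (tl e == tl f).
Proof.
move=> ee fe; apply/eqP/eqP => [/(congr1 val) /=|]; last by rewrite /ti => ->.
by rewrite !inordK ?num_lt //; apply: num_inj.
Qed.

Let hi_inj e f : e \in es -> f \in es -> (hi e == ti f) = (hd e == tl f).
Proof.
move=> ee fe; have [g ge ge'] := es_closed ee.
by rewrite -ge' -ti_inj // /ti ge'.
Qed.

Lemma walk_arcs : [seq (val a.1, val a.2) | a <- darcs D] =
  [seq (num (tl e), num (hd e)) | e <- es].
Proof.
rewrite -map_comp; apply/eq_in_map => e ee /=.
have [f fe fh] := es_closed ee.
by rewrite /ti /hi -fh !inordK ?num_lt //.
Qed.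

Lemma walk_outdeg e : e \in es ->
  @outdeg D (ti e) = count (fun f => tl f == tl e) es.
Proof.
by move=> ee; rewrite /outdeg /= count_map; apply: eq_in_count => f fe /=; apply: ti_inj.
Qed.

Lemma walk_has_walk : has_walk D.
Proof.
apply/andP; split=> //; apply/forallP => i.
have [e ee ei] := num_surj (ltn_ord i).
have <- : ti e = i by apply: val_inj; rewrite /= inordK ei ?ltn_ord.
by rewrite walk_outdeg // -has_count; apply/hasP; exists e => /=.
Qed.

Lemma walk_orientation : orientation_of_subgraph H D.
Proof.
have ex (i : 'I_n.+1) : exists e, (e \in es) && (num (tl e) == i).
  by have [e ee /eqP ei] := num_surj (ltn_ord i); exists e; rewrite ee.
pose phi := [ffun i : 'I_n.+1 => tl (xchoose (ex i))].
have phiE e : e \in es -> phi (ti e) = tl e.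
  rewrite ffunE; have /andP[fe /eqP fi] := xchooseP (ex (ti e)).
  by move=> ee; apply: num_inj => //; rewrite fi inordK // num_lt.
apply/existsP; exists phi; apply/andP; split.
  apply/injectiveP => i j; rewrite !ffunE => ij; apply: val_inj.
  have /andP[_ /eqP /= <-] := xchooseP (ex i).
  by have /andP[_ /eqP /= <-] := xchooseP (ex j); rewrite ij.
have sz : size es == size (darcs D) by rewrite size_map.
apply/existsP; exists (Tuple sz); rewrite /= es_uniq /=.
have : {subset es <= es} by [].
elim: {-2}es => //= e s IH sub; rewrite IH ?andbT; last first.
  by move=> f fs; apply: sub; rewrite inE fs orbT.
have ee : e \in es by apply: sub; rewrite mem_head.
have [f fe fh] := es_closed ee.
have -> : phi (hi e) = hd e by rewrite /hi -fh phiE.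
by rewrite phiE // es_ends.
Qed.

(** Places [D] within the ranges of the maxima that define [sd]. *)
Lemma walk_size : (n.+1 <= #|mvertex H|)%N /\ (size es <= #|medge H|)%N.
Proof.
split; last by rewrite cardE uniq_leq_size // => e _; rewrite mem_enum.
case/existsP: walk_orientation => phi /andP[/injectiveP phi_inj _].
by rewrite -[n.+1]card_ord; apply: leq_card phi_inj.
Qed.

Lemma walk_time : (sd_time M D <= sd M H)%N.
Proof.
have [h1 h2] := walk_size.
have max_le (F : nat -> nat) k N : (k < N)%N -> (F k <= \max_(i < N) F i)%N.
  by move=> kN; apply: (leq_bigmax (Ordinal kN)).
pose F m a := sd_time M (@Digraph m a).
pose F2 m k := \max_(a : k.-tuple ('I_m * 'I_m) |
  has_walk (@Digraph m a) && orientation_of_subgraph H (@Digraph m a)) F m a.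
pose F1 m := \max_(k < #|medge H|.+1) F2 m k.
have s2 : (size (darcs D) < #|medge H|.+1)%N by rewrite size_map ltnS.
have l2 : (F _ (darcs D) <= F2 n.+1 (size (darcs D)))%N.
  apply: (leq_bigmax_cond (in_tuple (darcs D))).
  by apply/andP; split; [apply: walk_has_walk | apply: walk_orientation].
have s1 : (n.+1 < #|mvertex H|.+1)%N by rewrite ltnS.
exact: leq_trans l2 (leq_trans (max_le (F2 n.+1) _ _ s2) (max_le F1 _ _ s1)).
Qed.

(** For stationary [p], the probability that a step of the walk traverses [e]. *)
Definition walk_flow (p : nat -> R) (e : medge H) : R :=
  p (num (tl e)) / (count (fun f => tl f == tl e) es)%:R.

Section Flow.

Variable p : nat -> R.
Hypothesis p_stationary : stationary (\row_(i < order D) p i).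

Lemma walk_flow_ge0 e : e \in es -> 0 <= walk_flow p e.
Proof.
move=> ee; case: p_stationary => p0 _ _; apply: divr_ge0 => //.
by have := p0 (ti e); rewrite mxE /= inordK // num_lt.
Qed.

Let es_count e : e \in es -> (0 < count (fun f => tl f == tl e) es)%N.
Proof. by move=> ee; rewrite -has_count; apply/hasP; exists e => /=. Qed.

Lemma walk_flow_gt0 : exists2 e, e \in es & 0 < walk_flow p e.
Proof.
case: p_stationary => p0 p1 _.
have /hasP[/= i _ pi] : has (fun i => true && (0 < (\row_(i < n.+1) p i) 0 i)) (index_enum 'I_n.+1).
  by rewrite -psumr_neq0 // p1 oner_eq0.
have [e ee ei] := num_surj (ltn_ord i); exists e => //.
apply: divr_gt0; first by rewrite mxE in pi; rewrite ei.
by rewrite ltr0n es_count.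
Qed.

(** For a tail [w], the outflow is the mass at [w] and the inflow is the corresponding entry of the
    mass times the transition matrix; these agree by stationarity. Otherwise [es_closed] makes both
    sums empty. *)
Lemma walk_flow_conserve w :
  \sum_(e <- es | tl e == w) walk_flow p e =
  \sum_(e <- es | hd e == w) walk_flow p e.
Proof.
case: (boolP (has (fun e => tl e == w) es)) => [/hasP[f fe /eqP fw]|nh]; last first.
  rewrite big_seq_cond [RHS]big_seq_cond !big_pred0 // => e; case: (boolP (e \in es)) => //= ee.
    have [f fe <-] := es_closed ee.
    by apply: contraNF nh => ?; apply/hasP; exists f.
  by apply: contraNF nh => ?; apply/hasP; exists e.
have -> : \sum_(e <- es | tl e == w) walk_flow p e = p (num w).
  rewrite (eq_bigr (fun=> p (num w) / (count (fun f => tl f == w) es)%:R)); last first.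
    by move=> e /eqP <-.
  rewrite big_const_seq iter_addr_0 -[LHS]mulr_natr divfK // pnatr_eq0 -lt0n -fw.
  exact: es_count.
case: p_stationary => _ _ /matrixP/(_ 0 (ti f)); rewrite !mxE /= inordK ?num_lt // fw => <-.
rewrite [RHS](partition_big ti xpredT) //=; apply: eq_bigr => i _; rewrite !mxE.
rewrite big_seq_cond (eq_bigr (fun=> p i / (@outdeg D i)%:R)); last first.
  move=> e /andP[ee /andP[_ /eqP <-]]; rewrite walk_outdeg //.
  by rewrite /walk_flow inordK // num_lt.
rewrite -big_seq_cond big_const_seq iter_addr_0 -[RHS]mulr_natr -mulrA [X in _ = _ * X]mulrC.
congr (_ * (_%:R / _)); rewrite /= count_map; apply: eq_in_count => e ee /=.
by rewrite xpair_eqE hi_inj // fw andbC.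
Qed.

End Flow.

(** Exposes only what a call of the method requires and returns, hiding the casts into ordinals. *)
Lemma walk_digraph : exists D' : digraph,
  [/\ order D' = n.+1,
      [seq (val a.1, val a.2) | a <- darcs D'] =
        [seq (num (tl e), num (hd e)) | e <- es],
      has_walk D', (sd_time M D' <= sd M H)%N &
      forall p : nat -> R,
        (forall i : 'I_(order D'), p i = sd_answer M D' 0 i) ->
        [/\ forall e, e \in es -> 0 <= walk_flow p e,
            exists2 e, e \in es & 0 < walk_flow p e &
            forall w, \sum_(e <- es | tl e == w) walk_flow p e =
                      \sum_(e <- es | hd e == w) walk_flow p e]].
Proof.
exists D; split=> //.
- exact: walk_arcs.
- exact: walk_has_walk.
- exact: walk_time.
move=> p pE.
have st : stationary (\row_(i < order D) p i).
  have -> : \row_(i < order D) p i = sd_answer M D.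
    by apply/rowP => i; rewrite mxE pE.
  exact: sd_correct walk_has_walk.
by split; [exact: walk_flow_ge0|exact: walk_flow_gt0|exact: walk_flow_conserve].
Qed.

End Walk.

(** * Total correctness of programs *)

Section Programs.

Variables (R : realType) (M : sd_method R).
Implicit Types (p q body : cmd) (s : state R).

(** Exhibiting an execution within the budget [K] covers termination and the legality of every call
    to the method. *)
Definition wp p (K : nat) s (Q : state R -> Prop) : Prop :=
  exists k s', [/\ (k <= K)%N, exec M p s k s' & Q s'].

Lemma wp_weaken p K K' s (Q Q' : state R -> Prop) :
  (K <= K')%N -> (forall s', Q s' -> Q' s') -> wp p K s Q -> wp p K' s Q'.
Proof.
move=> KK QQ [k [s' [kK ex Qs]]]; exists k, s'.
by split; [apply: leq_trans KK | | apply: QQ].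
Qed.

Lemma wp_seq p q K1 K2 s Q :
  wp p K1 s (fun s' => wp q K2 s' Q) -> wp (Seq p q) (K1 + K2) s Q.
Proof.
move=> [k1 [s1 [le1 ex1 [k2 [s2 [le2 ex2 Qs]]]]]].
by exists (k1 + k2)%N, s2; split; [apply: leq_add | apply: ExecSeq ex2 |].
Qed.

Lemma wp_if b p q K s Q :
  wp (if beval s b then p else q) K s Q -> wp (If b p q) (bcost b + K) s Q.
Proof.
move=> [k [s' [le ex Qs]]]; exists (bcost b + k)%N, s'.
by split => //; [rewrite leq_add2l | apply: ExecIf].
Qed.

Fixpoint simple p : bool :=
  match p with
  | Skip | NSet _ _ _ | RSet _ _ _ => true
  | Seq p q | If _ p q => simple p && simple q
  | While _ _ | Stat _ _ _ _ _ => false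
  end.

(** A conditional is charged for both branches: a bound independent of the state suffices. Loops and
    calls are excluded by [simple]. *)
Fixpoint cost p : nat :=
  match p with
  | Skip => 1
  | NSet _ i e => (ncost i + ncost e).+1
  | RSet _ i e => (ncost i + rcost e).+1
  | Seq p q => cost p + cost q
  | If b p q => bcost b + (cost p + cost q)
  | While _ _ | Stat _ _ _ _ _ => 0
  end%N.

Fixpoint run p s : state R :=
  match p with
  | NSet a i e => State (upd (nmem s) a (neval s i) (neval s e)) (rmem s)
  | RSet a i e => State (nmem s) (upd (rmem s) a (neval s i) (reval s e))
  | Seq p q => run q (run p s)
  | If b p q => if beval s b then run p s else run q s
  | Skip | While _ _ | Stat _ _ _ _ _ => s
  end.

Lemma wp_simple p s : simple p -> wp p (cost p) s (eq (run p s)).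
Proof.
elim: p s => //=.
- by move=> s _; exists 1%N, s; split=> //; apply: ExecSkip.
- by move=> a i e s _; do 2 eexists; split; [|exact: ExecNSet|].
- by move=> a i e s _; do 2 eexists; split; [|exact: ExecRSet|].
- move=> p IHp q IHq s /andP[sp sq]; apply: wp_seq.
  by apply: wp_weaken (IHp s sp) => // s' <-; apply: IHq.
- move=> b p IHp q IHq s /andP[sp sq]; apply: wp_if.
  case: ifP => _; first by apply: wp_weaken (IHp s sp) => //; apply: leq_addr.
  by apply: wp_weaken (IHq s sq) => //; apply: leq_addl.
Qed.

Fixpoint nat_writes p : seq nat :=
  match p with
  | NSet a _ _ => [:: a]
  | Seq p q | If _ p q => nat_writes p ++ nat_writes q
  | While _ p => nat_writes p
  | Skip | RSet _ _ _ | Stat _ _ _ _ _ => [::]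
  end.

Fixpoint real_writes p : seq nat :=
  match p with
  | RSet a _ _ => [:: a]
  | Seq p q | If _ p q => real_writes p ++ real_writes q
  | While _ p => real_writes p
  | Stat _ _ _ _ r => [:: r]
  | Skip | NSet _ _ _ => [::]
  end.

Definition frame p s s' : Prop :=
  (forall a, a \notin nat_writes p -> forall i, nmem s' a i = nmem s a i) /\
  (forall a, a \notin real_writes p -> forall i, rmem s' a i = rmem s a i).

Lemma frame_trans p s1 s2 s3 : frame p s1 s2 -> frame p s2 s3 -> frame p s1 s3.
Proof.
move=> [n1 r1] [n2 r2]; split=> a ap i; first by rewrite n2 ?n1.
by rewrite r2 ?r1.
Qed.

Lemma run_frame p s : frame p s (run p s).
Proof.
elim: p s => //=.
- move=> a i e s; split=> // b; rewrite inE => /negPf ab j.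
  by rewrite /= /upd ab.
- move=> a i e s; split=> // b; rewrite inE => /negPf ab j.
  by rewrite /= /upd ab.
- move=> p IHp q IHq s; have [n1 r1] := IHp s; have [n2 r2] := IHq (run p s).
  split=> a /=; rewrite mem_cat negb_or => /andP[a1 a2] i.
    by rewrite n2 ?n1.
  by rewrite r2 ?r1.
- move=> b p IHp q IHq s; have [n1 r1] := IHp s; have [n2 r2] := IHq s.
  split=> a /=; rewrite mem_cat negb_or => /andP[a1 a2] i; case: ifP => _.
  + exact: n1.
  + exact: n2.
  + exact: r1.
  + exact: r2.
Qed.

Definition counter : nexpr := NRead 5 (NConst 0).
Definition for_step body : cmd :=
  Seq body (NSet 5 (NConst 0) (NAdd counter (NConst 1))).
Definition for_loop (bound : nexpr) body : cmd :=
  Seq (NSet 5 (NConst 0) (NConst 0))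
      (While (BNot (NLe bound counter)) (for_step body)).
(** One loop test costs [(ncost bound).+4]; the constant term pays for the failing test and for
    resetting the counter, which costs 3. *)
Definition for_cost (bound : nexpr) body (N : nat) : nat :=
  (N * (cost (for_step body) + (ncost bound).+4) + (ncost bound).+4.+3)%N.

Lemma wp_for N bound body (J : nat -> state R -> Prop) s :
    simple body -> 5 \notin nat_writes body ->
    (forall s', frame (for_step body) s s' -> neval s' bound = N) ->
    J 0%N (run (NSet 5 (NConst 0) (NConst 0)) s) ->
    (forall k s', (k < N)%N -> frame (for_step body) s s' -> nmem s' 5 0 = k ->
       J k s' -> J k.+1 (run (for_step body) s')) ->
  wp (for_loop bound body) (for_cost bound body N) s
     (fun s' => frame (for_step body) s s' /\ J N s').
Proof.
move=> sb w5 bd J0 JS; set Q := fun s' => _.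
rewrite (_ : for_cost _ _ _ =
  3 + (N * (cost (for_step body) + (ncost bound).+4) + (ncost bound).+4))%N; last first.
  by rewrite /for_cost; lia.
apply: wp_seq; apply: wp_weaken (wp_simple s _) => // _ <-.
set s0 := run _ s in J0 *.
have f0 : frame (for_step body) s s0.
  split=> a aw i //; rewrite /= /upd; case: eqP => //= a5.
  by rewrite a5 /= mem_cat inE eqxx orbT in aw.
have c0 : nmem s0 5 0 = 0%N by [].
(* Induction on the number [d] of iterations left. *)
suff main d s1 : (d <= N)%N -> J (N - d)%N s1 -> frame (for_step body) s s1 ->
    nmem s1 5 0 = (N - d)%N ->
    wp (While (BNot (NLe bound counter)) (for_step body))
     (d * (cost (for_step body) + (ncost bound).+4) + (ncost bound).+4) s1 Q.
  by have := main N s0 (leqnn N); rewrite subnn; apply.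
elim: d s1 => [|d IH] s1 dN J1 f1 c1.
  exists (ncost bound + 2).+2, s1; split; first by lia.
    by apply: ExecWhileStop; rewrite /= negbK bd // c1 subn0.
  by rewrite subn0 in J1.
have [|k1 [s2 [le2 ex2 E2]]] := @wp_simple (for_step body) s1.
  by rewrite /= sb.
have f2 : frame (for_step body) s1 s2 by rewrite -E2; apply: run_frame.
have kN : (N - d.+1 < N)%N by lia.
have J2 := JS _ _ kN f1 c1 J1; rewrite E2 in J2.
have c2 : nmem s2 5 0 = (N - d)%N.
  rewrite -E2 /= /upd !eqxx /=; have [-> // _] := run_frame body s1.
  by rewrite c1; lia.
rewrite (_ : (N - d.+1).+1 = (N - d)%N) in J2; last by lia.
have [k3 [s3 [le3 ex3 Q3]]] := IH s2 (ltnW dN) J2 (frame_trans f1 f2) c2.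
exists ((ncost bound + 2).+2 + k1 + k3)%N, s3; split => //; first by lia.
apply: ExecWhileLoop ex2 ex3.
by rewrite /= bd // c1 -ltnNge; lia.
Qed.

End Programs.

(** * The program *)

(* Arrays of naturals:                     Arrays of reals:
    0 numbers of vertices and arcs          0 c
    1, 2, 3 sources, targets, kinds         1 t
    4 membership in F                       2 icap
    5 loop counter                          3 ocap
    6, 7 zs, zt                             4 sum of t over the arcs entering w
    8 number of fluid arcs leaving w        5 number of moves with tail w
    9 is there a source?                    6 stationary distribution
    10 is the algorithm finished?           7 x
    11 has F changed?                       8 sum of x over the arcs entering w
    12, 13 order and size of the digraph    9 step length
    14 rank of w among the tails of moves
    15, 16 mtail, mhead
    17 moves
    18, 19 tails and heads of the digraph
   The vertex z of the contracted graph is numbered after all the vertices. *)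

Notation cell a := (NRead a (NConst 0)).
Notation cur := (cell 5).
Notation arc_bound := (NRead 0 (NConst 1)).
Notation node_bound := (NAdd (cell 0) (NConst 1)).
Notation BOr b1 b2 := (BNot (BAnd (BNot b1) (BNot b2))).
Notation RLt r1 r2 := (BNot (RLe r2 r1)).
Notation is_fluid := (NLe (NConst 1) (NRead 4 cur)).
Notation is_move := (NLe (NConst 1) (NRead 17 cur)).
Notation thru := (RRead 1 cur).
Notation rate := (RRead 7 cur).
Notation blocked_head := (NLe (NRead 8 (NRead 7 cur)) (NConst 0)).
Notation insum_head := (RRead 4 (NRead 7 cur)).
Notation step_length := (RRead 9 (NConst 0)).

Definition contract_end (ends contracted capacity : nat) : cmd :=
  If (BAnd (NLe (NRead 3 (NRead ends cur)) (NConst 1))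
           (NLe (NConst 1) (NRead 3 (NRead ends cur))))
     (Seq (NSet contracted cur (NRead ends cur)) (RSet capacity cur ROne))
     (Seq (NSet contracted cur (cell 0))
          (RSet capacity cur (RRead 0 (NRead ends cur)))).

Definition init_body : cmd :=
  Seq (contract_end 1 6 2)
 (Seq (contract_end 2 7 3)
      (If (BAnd (NLe (cell 0) (NRead 6 cur)) (NLe (cell 0) (NRead 7 cur)))
          (If (RLe (RRead 3 cur) (RRead 2 cur))
              (RSet 1 cur (RRead 3 cur))
              (Seq (RSet 1 cur (RRead 2 cur)) (NSet 4 cur (NConst 1))))
          (NSet 4 cur (NConst 1)))).

Definition clear_body : cmd :=
  Seq (NSet 8 cur (NConst 0))
 (Seq (RSet 4 cur RZero) (Seq (RSet 5 cur RZero) (RSet 8 cur RZero))).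

Definition scan_body : cmd :=
  Seq (RSet 4 (NRead 7 cur) (RAdd insum_head thru))
      (If is_fluid
         (Seq (NSet 8 (NRead 6 cur) (NAdd (NRead 8 (NRead 6 cur)) (NConst 1)))
              (If (BAnd (NLe (cell 0) (NRead 6 cur)) (RLt thru (RRead 2 cur)))
                  (NSet 9 (NConst 0) (NConst 1)) Skip))
         Skip).

Definition saturate_body : cmd :=
  If (BAnd is_fluid
        (BOr (RLe (RRead 3 cur) thru)
             (BAnd blocked_head (RLe insum_head (RAdd thru thru)))))
     (Seq (NSet 4 cur (NConst 0)) (NSet 11 (NConst 0) (NConst 1))) Skip.

(** Out-degrees are counted in a real array because [rate_body] divides by them. *)
Definition move_body : cmd :=
  Seq (NSet 17 cur (NConst 0))
 (Seq (If is_fluid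
         (Seq (NSet 15 cur (NRead 6 cur))
         (Seq (NSet 16 cur (NRead 7 cur))
              (If (RLt thru (RRead 2 cur)) (NSet 17 cur (NConst 1)) Skip)))
         (Seq (NSet 15 cur (NRead 7 cur))
         (Seq (NSet 16 cur (NRead 6 cur))
              (If (BAnd blocked_head (RLt RZero thru))
                  (NSet 17 cur (NConst 1)) Skip))))
      (If is_move
          (RSet 5 (NRead 15 cur) (RAdd (RRead 5 (NRead 15 cur)) ROne)) Skip)).

(** Only nodes with a leaving move advance the rank. A later lookup concerns a tail or a head of a
    move, and every head is a tail by [moves_head]. *)
Definition number_body : cmd :=
  Seq (NSet 14 cur (cell 12))
      (If (RLt RZero (RRead 5 cur))
          (NSet 12 (NConst 0) (NAdd (cell 12) (NConst 1))) Skip).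

Definition list_body : cmd :=
  If is_move
     (Seq (NSet 18 (cell 13) (NRead 14 (NRead 15 cur)))
     (Seq (NSet 19 (cell 13) (NRead 14 (NRead 16 cur)))
          (NSet 13 (NConst 0) (NAdd (cell 13) (NConst 1)))))
     Skip.

Definition rate_body : cmd :=
  Seq (If is_move
          (RSet 7 cur (RDiv (RRead 6 (NRead 14 (NRead 15 cur)))
                            (RRead 5 (NRead 15 cur))))
          (RSet 7 cur RZero))
      (RSet 8 (NRead 7 cur) (RAdd (RRead 8 (NRead 7 cur)) rate)).

Definition min_cmd (a b : rexpr) : cmd :=
  If (BAnd (RLt RZero b)
           (BOr (RLt step_length RZero) (RLt (RDiv a b) step_length)))
     (RSet 9 (NConst 0) (RDiv a b)) Skip.

Definition step_body : cmd :=
  If is_fluid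
     (Seq (min_cmd (RSub (RRead 3 cur) thru) rate)
     (Seq (min_cmd (RSub (RRead 2 cur) thru) rate)
          (If blocked_head
              (min_cmd (RSub insum_head (RAdd thru thru))
                       (RRead 8 (NRead 7 cur)))
              Skip)))
     (min_cmd thru rate).

Definition push_body : cmd :=
  If is_fluid (RSet 1 cur (RAdd thru (RMul step_length rate)))
              (RSet 1 cur (RSub thru (RMul step_length rate))).

Definition push_cmd : cmd :=
  Seq (Seq (NSet 12 (NConst 0) (NConst 0)) (NSet 13 (NConst 0) (NConst 0)))
 (Seq (for_loop arc_bound move_body)
 (Seq (for_loop node_bound number_body)
 (Seq (for_loop arc_bound list_body)
 (Seq (Stat (cell 12) (cell 13) 18 19 6)
 (Seq (for_loop arc_bound rate_body)
 (Seq (RSet 9 (NConst 0) (RSub RZero ROne))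
 (Seq (for_loop arc_bound step_body)
      (for_loop arc_bound push_body)))))))).

(** A saturation makes the counts of fluid leaving arcs stale, so the round stops there and the next
    one recomputes them. *)
Definition round_cmd : cmd :=
  Seq (Seq (NSet 9 (NConst 0) (NConst 0)) (NSet 11 (NConst 0) (NConst 0)))
 (Seq (for_loop node_bound clear_body)
 (Seq (for_loop arc_bound scan_body)
      (If (NLe (cell 9) (NConst 0))
          (NSet 10 (NConst 0) (NConst 1))
          (Seq (for_loop arc_bound saturate_body)
               (If (NLe (NConst 1) (cell 11)) Skip push_cmd))))).

Definition algorithm : cmd :=
  Seq (for_loop arc_bound init_body)
      (While (NLe (cell 10) (NConst 0)) round_cmd).

(** Loop rule with an invariant on the list of arcs already treated. The invariant must ignore the
    counter, which the loop itself advances; [uniq] says that the current arc is new. *)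
Lemma wp_arcs (R : realType) (M : sd_method R) (A : finType) (body : cmd)
    (J : seq A -> state R -> Prop) (s : state R) :
    simple body -> all (fun a => a \notin nat_writes body) [:: 0; 5] ->
    nmem s 0 1 = #|A| -> J [::] s ->
    (forall l s' k, J l s' -> J l (State (upd (nmem s') 5 0 k) (rmem s'))) ->
    (forall l e s', uniq (rcons l e) -> frame (for_step body) s s' ->
       nmem s' 5 0 = enum_rank e -> J l s' -> J (rcons l e) (run body s')) ->
  wp M (for_loop arc_bound body) (for_cost arc_bound body #|A|) s
     (fun s' => frame (for_step body) s s' /\ J (enum A) s').
Proof.
move=> sb /and3P[w0 w5 _] s0 J0 Jc JS.
apply: (wp_weaken (leqnn _) _ (@wp_for _ M #|A| _ _ (fun k => J (take k (enum A))) s sb w5 _ _ _)).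
- by move=> s'; rewrite take_oversize // -cardE.
- by move=> s' [f _] /=; rewrite f ?s0 //= mem_cat negb_or w0.
- by rewrite take0; apply: Jc.
move=> k s' kA f s'k Jk.
pose e := enum_val (Ordinal kA).
have nthe : nth e (enum A) k = e.
  by rewrite {2}/e /enum_val; apply: set_nth_default; rewrite -cardE.
have take_e : take k.+1 (enum A) = rcons (take k (enum A)) e.
  by rewrite (take_nth e) ?nthe // -cardE.
rewrite take_e; apply: Jc; apply: JS => //; last by rewrite enum_valK.
by rewrite -take_e take_uniq ?enum_uniq.
Qed.

Lemma sum_rcons (V : nmodType) (I : Type) (l : seq I) (i : I) (P : pred I)
    (F : I -> V) :
  \sum_(j <- rcons l i | P j) F j =
  \sum_(j <- l | P j) F j + (if P i then F i else 0).
Proof.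
by rewrite -cats1 big_cat big_cons big_nil /=; case: ifP; rewrite ?addr0.
Qed.

Lemma run_seq (R : realType) p q (s : state R) :
  run (Seq p q) s = run q (run p s).
Proof. by []. Qed.

Lemma run_if (R : realType) b p q (s : state R) :
  run (If b p q) s = run (if beval s b then p else q) s.
Proof. by rewrite /=; case: ifP. Qed.

Lemma run_min_cmd (R : realType) a b (s : state R) :
  let s' := run (min_cmd a b) s in
  [/\ nmem s' = nmem s,
      rmem s' 9 0 = min_step (rmem s 9 0) (reval s a, reval s b) &
      forall c i, c != 9%N -> rmem s' c i = rmem s c i].
Proof.
rewrite /min_cmd /= negb_and !negbK -!ltNge /min_step /=.
case: ifP => _; split=> // c i /negPf c9.
by rewrite /= /upd c9.
Qed.

(** * Gapless renumbering of the tails of moves *)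

Section Rank.

Variable pos : pred nat.

Definition rank_of j : nat := count pos (iota 0 j).

Lemma rank_ofS j : rank_of j.+1 = (rank_of j + pos j)%N.
Proof. by rewrite /rank_of -[j.+1]addn1 iotaD count_cat /= addn0. Qed.

Lemma rank_of_lt i j : pos i -> (i < j)%N -> (rank_of i < rank_of j)%N.
Proof.
move=> pi; elim: j => // j IH; rewrite ltnS leq_eqVlt rank_ofS.
by case/orP => [/eqP <-|/IH]; [rewrite pi addn1 | lia].
Qed.

Lemma rank_of_inj i j : pos i -> pos j -> rank_of i = rank_of j -> i = j.
Proof.
move=> pi pj ij; case: (ltngtP i j) => // lt.
  by have := rank_of_lt pi lt; rewrite ij ltnn.
by have := rank_of_lt pj lt; rewrite ij ltnn.
Qed.

Lemma rank_of_surj k N : (k < rank_of N)%N ->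
  exists2 j, (j < N)%N & pos j /\ rank_of j = k.
Proof.
elim: N => // N IH; rewrite rank_ofS; case: (ltnP k (rank_of N)) => [/IH[j jN h] _|le lt].
  by exists j => //; apply: ltnW.
by exists N => //; case: (pos N) lt; lia.
Qed.

End Rank.

(** * Effect of each pass on memory *)

Section Passes.

Variables (R : realType) (M : sd_method R) (H : multigraph) (z : mvertex H).
Variables (zs zt : medge H -> mvertex H) (icap ocap : medge H -> R).
Variables (nV : nat) (index_of : mvertex H -> nat).

Hypothesis index_inj : injective index_of.
Hypothesis index_le : forall w, (index_of w <= nV)%N.
Hypothesis index_z : index_of z = nV.

Implicit Types (s : state R) (t x : medge H -> R) (F : {set medge H}).
Implicit Types (e : medge H) (w : mvertex H) (l : seq (medge H)).

Notation rk e := (nat_of_ord (enum_rank e)).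

Record layout s : Prop := Layout {
  layout_nodes : nmem s 0 0 = nV;
  layout_arcs : nmem s 0 1 = #|medge H|;
  layout_zs : forall e, nmem s 6 (rk e) = index_of (zs e);
  layout_zt : forall e, nmem s 7 (rk e) = index_of (zt e);
  layout_icap : forall e, rmem s 2 (rk e) = icap e;
  layout_ocap : forall e, rmem s 3 (rk e) = ocap e
}.

Record holds t F s : Prop := Holds {
  holds_layout : layout s;
  holds_t : forall e, rmem s 1 (rk e) = t e;
  holds_F : forall e, nmem s 4 (rk e) = (e \in F)
}.

Lemma layout_frame p s s' : frame p s s' ->
  all (fun a => a \notin nat_writes p) [:: 0; 6; 7]%N ->
  all (fun a => a \notin real_writes p) [:: 2; 3]%N ->
  layout s -> layout s'.
Proof.
move=> [fn fr] /and4P[n0 n6 n7 _] /and3P[r2 r3 _] [h1 h2 h3 h4 h5 h6].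
by split=> *; rewrite ?fn ?fr.
Qed.

Lemma holds_frame p t F s s' : frame p s s' ->
  all (fun a => a \notin nat_writes p) [:: 0; 6; 7; 4]%N ->
  all (fun a => a \notin real_writes p) [:: 2; 3; 1]%N ->
  holds t F s -> holds t F s'.
Proof.
move=> fr /and5P[n0 n6 n7 n4 _] /and4P[r2 r3 r1 _] [h1 h2 h3].
split; first by apply: layout_frame fr _ _ h1; rewrite /= ?n0 ?n6 ?n7 ?r2 ?r3.
  by move=> e; rewrite fr.2.
by move=> e; rewrite fr.1.
Qed.

Lemma rk_eq e f : (rk e == rk f) = (e == f).
Proof. by apply/eqP/eqP => [/ord_inj/enum_rank_inj|->]. Qed.

Lemma index_eq w w' : (index_of w == index_of w') = (w == w').
Proof. exact: inj_eq. Qed.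

Lemma index_geq w : (nV <= index_of w)%N = (w == z).
Proof. by rewrite -index_eq index_z eqn_leq index_le. Qed.

Lemma clear_pass s : nmem s 0 0 = nV ->
  wp M (for_loop node_bound clear_body) (for_cost node_bound clear_body nV.+1) s
   (fun s' => frame (for_step clear_body) s s' /\
      forall j, (j <= nV)%N -> [/\ nmem s' 8 j = 0%N, rmem s' 4 j = 0,
                    rmem s' 5 j = 0 & rmem s' 8 j = 0]).
Proof.
move=> s0; pose J k s' := forall j, (j < k)%N ->
  [/\ nmem s' 8 j = 0%N, rmem s' 4 j = 0 :> R, rmem s' 5 j = 0 :> R & rmem s' 8 j = 0 :> R].
apply: wp_weaken (leqnn _) _ (@wp_for _ M nV.+1 _ _ J s _ _ _ _ _) => //.
  by move=> s' [f _] /=; rewrite f // s0 addn1.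
move=> k s' _ _ c h j; rewrite /for_step /clear_body /= /upd /= c ltnS leq_eqVlt.
by case: eqP => //= _ /h.
Qed.

Lemma scan_pass t F s : holds t F s -> nmem s 9 0 = 0%N ->
  (forall w, nmem s 8 (index_of w) = 0%N) ->
  (forall w, rmem s 4 (index_of w) = 0) ->
  wp M (for_loop arc_bound scan_body) (for_cost arc_bound scan_body #|medge H|) s
   (fun s' => frame (for_step scan_body) s s' /\
     [/\ forall w, rmem s' 4 (index_of w) = insum zt t w,
         forall w, (nmem s' 8 (index_of w) <= 0)%N = blocked zs F w &
         nmem s' 9 0 = has_source z zs icap t F]).
Proof.
move=> [[h1 h2 h3 h4 h5 h6] ht hF] s9 s8 s4.
pose J l s' := [/\ forall w, rmem s' 4 (index_of w) = \sum_(e <- l | zt e == w) t e,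
  forall w, nmem s' 8 (index_of w) = count (fun e => (e \in F) && (zs e == w)) l &
  nmem s' 9 0 = has (fun e => (zs e == z) && active icap t F e) l].
apply: wp_weaken (leqnn _) _ (@wp_arcs _ M _ _ J s _ _ h2 _ _ _) => //.
- move=> s' [f [j1 j2 j3]]; split=> //; split.
  + by move=> w; rewrite j1 big_enum_cond.
  + move=> w; rewrite j2 leqNgt -has_count; apply/hasPn/forallP => h e.
      by have := h e (mem_enum _ e); rewrite negb_and implybE.
    by move=> _; rewrite negb_and -implybE.
  + rewrite j3; congr (nat_of_bool _); apply/hasP/existsP => [[e _]|[e]]; exists e => //.
    by rewrite mem_enum.
- by split=> [w|w|] //; rewrite ?s4 ?s8 ?big_nil.
move=> l e s' _ [fn fr] c [j1 j2 j3].
have e4 : nmem s' 4 (rk e) = (e \in F) by rewrite fn.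
have e6 : nmem s' 6 (rk e) = index_of (zs e) by rewrite fn.
have e7 : nmem s' 7 (rk e) = index_of (zt e) by rewrite fn.
have e1 : rmem s' 1 (rk e) = t e by rewrite fr.
have e2 : rmem s' 2 (rk e) = icap e by rewrite fr.
have e0 : nmem s' 0 0 = nV by rewrite fn.
rewrite /scan_body /= /upd /= c e0 e1 e2 e4 e6 e7 lt0b index_geq -ltNge.
have J1 w : (if index_of w == index_of (zt e) then rmem s' 4 (index_of (zt e)) + t e
    else rmem s' 4 (index_of w)) = \sum_(i <- rcons l e | zt i == w) t i.
  rewrite index_eq sum_rcons !j1 eq_sym.
  by case: eqP => [->|]; rewrite ?addr0.
split=> [w|w|]; case: ifP => eF //=; rewrite ?eF //.
- by case: ifP => _; apply: J1.
- rewrite -cats1 count_cat /= eF addn0 /= -j2.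
  by case: ifP => _ /=; rewrite index_eq [w == _]eq_sym; case: eqP => [->|_]; rewrite ?addn0.
- by rewrite -cats1 count_cat /= eF !addn0.
- by rewrite has_rcons /active eF /=; case: ifP.
- by rewrite has_rcons /active eF andbF.
Qed.

(** Blocking and inflow are read from arrays that the pass does not write, so all saturations are
    decided with respect to the initial [F], as in [saturate]. *)
Lemma saturate_pass t F s : holds t F s -> nmem s 11 0 = 0%N ->
  (forall w, rmem s 4 (index_of w) = insum zt t w) ->
  (forall w, (nmem s 8 (index_of w) <= 0)%N = blocked zs F w) ->
  wp M (for_loop arc_bound saturate_body)
    (for_cost arc_bound saturate_body #|medge H|) s
   (fun s' => frame (for_step saturate_body) s s' /\
     holds t (saturate zs zt ocap t F) s' /\
     nmem s' 11 0 = ~~ settled zs zt ocap t F).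
Proof.
move=> hs s11 s4 s8; have [[h1 h2 h3 h4 h5 h6] ht hF] := hs.
pose sat := saturable zs zt ocap t F.
pose J l s' := [/\ forall e, nmem s' 4 (rk e) = (e \in F) && ~~ ((e \in l) && sat e) :> nat &
  nmem s' 11 0 = has sat l].
apply: wp_weaken (leqnn _) _ (@wp_arcs _ M _ _ J s _ _ h2 _ _ _) => //.
- move=> s' [f [j1 j2]]; split=> //; split.
    split; first by apply: layout_frame f _ _ (holds_layout hs).
      by move=> e; rewrite f.2 // ht.
    by move=> e; rewrite j1 mem_enum !inE.
  rewrite j2; congr (nat_of_bool _).
  apply/hasP/forallPn => -[e]; first by move=> _ he; exists e; rewrite negbK.
  by rewrite negbK => he; exists e; rewrite ?mem_enum.
- by split=> [e|] //; rewrite hF andbT.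
move=> l e s' ul [fn fr] c [j1 j2].
have el : e \notin l by move: ul; rewrite rcons_uniq => /andP[].
have e4 : nmem s' 4 (rk e) = (e \in F) by rewrite j1 (negPf el) andbT.
have e7 : nmem s' 7 (rk e) = index_of (zt e) by rewrite fn.
have e1 : rmem s' 1 (rk e) = t e by rewrite fr.
have e3 : rmem s' 3 (rk e) = ocap e by rewrite fr.
have e8 w : (nmem s' 8 (index_of w) <= 0)%N = blocked zs F w by rewrite fn // s8.
have es w : rmem s' 4 (index_of w) = insum zt t w by rewrite fr.
rewrite /saturate_body /= c e1 e3 e4 e7 e8 es lt0b negb_and !negbK.
rewrite -[_ && _]/(sat e); case: ifP => se.
  split; last by rewrite has_rcons se.
  move=> f; rewrite /upd /= rk_eq mem_rcons inE; case: eqP => [->|_] //=.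
  by rewrite se andbF.
split; last by rewrite has_rcons se.
by move=> f; rewrite j1 mem_rcons inE; case: eqP => [->|] //=; rewrite se andbF.
Qed.


Lemma move_pass t F s : holds t F s ->
  (forall w, (nmem s 8 (index_of w) <= 0)%N = blocked zs F w) ->
  (forall j, (j <= nV)%N -> rmem s 5 j = 0) ->
  wp M (for_loop arc_bound move_body) (for_cost arc_bound move_body #|medge H|) s
   (fun s' => frame (for_step move_body) s s' /\
     [/\ forall e, nmem s' 15 (rk e) = index_of (mtail zs zt F e),
         forall e, nmem s' 16 (rk e) = index_of (mhead zs zt F e),
         forall e, nmem s' 17 (rk e) = moves zs zt icap t F e &
         forall j, (j <= nV)%N -> rmem s' 5 j =
           (count (fun e => index_of (mtail zs zt F e) == j)
              [seq e <- enum (medge H) | moves zs zt icap t F e])%:R]).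
Proof.
move=> [[h1 h2 h3 h4 h5 h6] ht hF] s8 s5.
pose mv := moves zs zt icap t F.
pose J l s' := (forall e, e \in l -> [/\
      nmem s' 15 (rk e) = index_of (mtail zs zt F e),
      nmem s' 16 (rk e) = index_of (mhead zs zt F e) &
      nmem s' 17 (rk e) = mv e]) /\
  forall j, (j <= nV)%N -> rmem s' 5 j =
    (count (fun e => index_of (mtail zs zt F e) == j) [seq e <- l | mv e])%:R.
apply: wp_weaken (leqnn _) _ (@wp_arcs _ M _ _ J s _ _ h2 _ _ _) => //.
  by move=> s' [f [j1 j2]]; split=> //; split=> // e; case: (j1 e); rewrite ?mem_enum.
move=> l e s' ul [fn fr] c [j1 j2].
have el : e \notin l by move: ul; rewrite rcons_uniq => /andP[].
have e4 : nmem s' 4 (rk e) = (e \in F) by rewrite fn.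
have e6 : nmem s' 6 (rk e) = index_of (zs e) by rewrite fn.
have e7 : nmem s' 7 (rk e) = index_of (zt e) by rewrite fn.
have e1 : rmem s' 1 (rk e) = t e by rewrite fr.
have e2 : rmem s' 2 (rk e) = icap e by rewrite fr.
have e8 w : (nmem s' 8 (index_of w) <= 0)%N = blocked zs F w by rewrite fn // s8.
have me : mv e = if e \in F then t e < icap e else blocked zs F (zt e) && (0 < t e).
  by [].
have J2 j : (j <= nV)%N ->
    (count (fun e => index_of (mtail zs zt F e) == j) [seq e <- rcons l e | mv e])%:R =
    rmem s' 5 j + ((mv e && (index_of (mtail zs zt F e) == j))%:R : R).
  move=> jV; rewrite filter_rcons j2 //; case: (mv e); rewrite ?addr0 //.
  by rewrite -cats1 count_cat /= addn0 natrD.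
have in_l f : f \in rcons l e -> f = e \/ f != e /\ f \in l.
  rewrite mem_rcons inE => /orP[/eqP|fl]; [by left|right; split=> //].
  by apply: contraTneq fl => ->.
rewrite /move_body /= /upd /= c e1 e2 e4 e6 e7 e8 lt0b -!ltNge.
move: me; case: ifP => eF me; rewrite -me.
  case mve: (mv e) => /=; rewrite ?c ?eqxx /=.
    split=> [f|w wV].
      case/in_l => [->|[/negPf fe fl]]; rewrite /= ?eqxx ?rk_eq ?fe /=.
        by rewrite /mtail /mhead eF mve.
      by have [? ? ?] := j1 f fl.
    rewrite J2 // mve /= /mtail eF eq_sym.
    by case: eqP => [->|]; rewrite ?addr0.
  split=> [f|w wV]; last by rewrite J2 // mve addr0.
  case/in_l => [->|[/negPf fe fl]]; rewrite /= ?eqxx ?rk_eq ?fe /=.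
    by rewrite /mtail /mhead eF mve.
  by have [? ? ?] := j1 f fl.
case mve: (mv e) => /=; rewrite ?c ?eqxx /=.
  split=> [f|w wV].
    case/in_l => [->|[/negPf fe fl]]; rewrite /= ?eqxx ?rk_eq ?fe /=.
      by rewrite /mtail /mhead eF mve.
    by have [? ? ?] := j1 f fl.
  rewrite J2 // mve /= /mtail eF eq_sym.
  by case: eqP => [->|]; rewrite ?addr0.
split=> [f|w wV]; last by rewrite J2 // mve addr0.
case/in_l => [->|[/negPf fe fl]]; rewrite /= ?eqxx ?rk_eq ?fe /=.
  by rewrite /mtail /mhead eF mve.
by have [? ? ?] := j1 f fl.
Qed.

Lemma number_pass s : nmem s 0 0 = nV -> nmem s 12 0 = 0%N ->
  wp M (for_loop node_bound number_body) (for_cost node_bound number_body nV.+1) s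
   (fun s' => frame (for_step number_body) s s' /\
      (forall w, nmem s' 14 (index_of w) = rank_of (fun i => 0 < rmem s 5 i) (index_of w)) /\
      nmem s' 12 0 = rank_of (fun i => 0 < rmem s 5 i) nV.+1).
Proof.
move=> s0 s12; pose J k s' := (forall j, (j < k)%N -> nmem s' 14 j = rank_of (fun i => 0 < rmem s 5 i) j) /\
  nmem s' 12 0 = rank_of (fun i => 0 < rmem s 5 i) k.
apply: wp_weaken (leqnn _) _ (@wp_for _ M nV.+1 _ _ J s _ _ _ _ _) => //.
- by move=> s' [? [h ?]]; split=> //; split=> // w; apply: h; rewrite ltnS.
- by move=> s' [f _] /=; rewrite f // s0 addn1.
move=> k s' _ [_ fr] c [j1 j2]; rewrite /for_step /number_body /= /upd /= c fr // -ltNge.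
have j1' j : (j < k.+1)%N -> (if j == k then nmem s' 12 0 else nmem s' 14 j) = rank_of (fun i => 0 < rmem s 5 i) j.
  by rewrite ltnS leq_eqVlt; case: eqP => [->|_ /j1].
split; first by case: ifP.
by rewrite rank_ofS; case: ifP => h /=; rewrite j2 ?addn0.
Qed.

Lemma list_pass s (mv : pred (medge H)) (tl hd : medge H -> mvertex H) (nu : mvertex H -> nat) :
  nmem s 0 1 = #|medge H| -> nmem s 13 0 = 0%N ->
  (forall w, nmem s 14 (index_of w) = nu w) ->
  (forall e, nmem s 15 (rk e) = index_of (tl e)) ->
  (forall e, nmem s 16 (rk e) = index_of (hd e)) ->
  (forall e, nmem s 17 (rk e) = mv e) ->
  wp M (for_loop arc_bound list_body) (for_cost arc_bound list_body #|medge H|) s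
   (fun s' => frame (for_step list_body) s s' /\
     [seq (nmem s' 18 k, nmem s' 19 k) | k <- iota 0 (nmem s' 13 0)] =
     [seq (nu (tl e), nu (hd e)) | e <- [seq e <- enum (medge H) | mv e]]).
Proof.
move=> s1 s13 s14 s15 s16 s17.
pose J l s' := nmem s' 13 0 = size [seq e <- l | mv e] /\
  [seq (nmem s' 18 k, nmem s' 19 k) | k <- iota 0 (nmem s' 13 0)] =
     [seq (nu (tl e), nu (hd e)) | e <- [seq e <- l | mv e]].
apply: wp_weaken (leqnn _) _ (@wp_arcs _ M _ _ J s _ _ s1 _ _ _) => //.
- by move=> s' [? []].
- by rewrite /J s13.
move=> l e s' ul [fn fr] c [j1 j2].
have e15 : nmem s' 15 (rk e) = index_of (tl e) by rewrite fn.
have e16 : nmem s' 16 (rk e) = index_of (hd e) by rewrite fn.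
have e17 : nmem s' 17 (rk e) = mv e by rewrite fn.
have e14 w : nmem s' 14 (index_of w) = nu w by rewrite fn.
rewrite /list_body /= /upd /= c e15 e16 e17 !e14 lt0b.
rewrite /J filter_rcons; case: ifP => // mve; split; first by rewrite /= j1 size_rcons addn1.
rewrite /= iotaD map_cat map_rcons -cats1 -j2 /= add0n !eqxx; congr (_ ++ _).
(* Earlier entries lie strictly below the write position and are preserved. *)
by apply/eq_in_map => k; rewrite mem_iota add0n => /andP[_ /ltn_eqF->].
Qed.

Lemma rate_pass t F s (mv : pred (medge H)) (tl : medge H -> mvertex H)
    (nu : mvertex H -> nat) (dg : mvertex H -> R) : holds t F s ->
  (forall w, nmem s 14 (index_of w) = nu w) ->
  (forall e, nmem s 15 (rk e) = index_of (tl e)) ->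
  (forall e, nmem s 17 (rk e) = mv e) ->
  (forall w, rmem s 5 (index_of w) = dg w) ->
  (forall w, rmem s 8 (index_of w) = 0) ->
  let x e := if mv e then rmem s 6 (nu (tl e)) / dg (tl e) else 0 in
  wp M (for_loop arc_bound rate_body) (for_cost arc_bound rate_body #|medge H|) s
   (fun s' => frame (for_step rate_body) s s' /\
     (forall e, rmem s' 7 (rk e) = x e) /\
     (forall w, rmem s' 8 (index_of w) = insum zt x w)).
Proof.
move=> [[h1 h2 h3 h4 h5 h6] ht hF] s14 s15 s17 s5 s8 x.
pose J l s' := (forall e, e \in l -> rmem s' 7 (rk e) = x e) /\
  (forall w, rmem s' 8 (index_of w) = \sum_(e <- l | zt e == w) x e).
apply: wp_weaken (leqnn _) _ (@wp_arcs _ M _ _ J s _ _ h2 _ _ _) => //.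
- move=> s' [f [j1 j2]]; split=> //; split=> [e|w]; first by rewrite j1 ?mem_enum.
  by rewrite j2 big_enum_cond.
- by split=> // w; rewrite big_nil.
move=> l e s' ul [fn fr] c [j1 j2].
have e7 : nmem s' 7 (rk e) = index_of (zt e) by rewrite fn.
have J1 f : f \in rcons l e -> (if rk f == rk e then x e else rmem s' 7 (rk f)) = x f.
  by rewrite mem_rcons inE rk_eq; case: eqP => [->//|_ /j1].
have J2 w : (if index_of w == index_of (zt e)
     then rmem s' 8 (index_of (zt e)) + x e
     else rmem s' 8 (index_of w)) = \sum_(i <- rcons l e | zt i == w) x i.
  rewrite index_eq sum_rcons !j2 eq_sym.
  by case: eqP => [->|]; rewrite ?addr0.
have e15 : nmem s' 15 (rk e) = index_of (tl e) by rewrite fn.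
have e17 : nmem s' 17 (rk e) = mv e by rewrite fn.
have e14 w : nmem s' 14 (index_of w) = nu w by rewrite fn.
have e5 w : rmem s' 5 (index_of w) = dg w by rewrite fr.
have e6 i : rmem s' 6 i = rmem s 6 i by rewrite fr.
rewrite /rate_body /= /upd /= c e15 e17 e14 e5 e6 lt0b.
move: J1 J2; rewrite {1 3}/x; case: ifP => me J1 J2.
  by rewrite /= ?c ?e7 ?eqxx; split.
by rewrite /= ?c ?e7 ?eqxx; split.
Qed.

Lemma step_pass t F s x : holds t F s -> rmem s 9 0 = -1 ->
  (forall w, (nmem s 8 (index_of w) <= 0)%N = blocked zs F w) ->
  (forall w, rmem s 4 (index_of w) = insum zt t w) ->
  (forall e, rmem s 7 (rk e) = x e) ->
  (forall w, rmem s 8 (index_of w) = insum zt x w) ->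
  wp M (for_loop arc_bound step_body) (for_cost arc_bound step_body #|medge H|) s
   (fun s' => frame (for_step step_body) s s' /\
     rmem s' 9 0 = foldl (@min_step R) (-1)
       (flatten [seq constraints zs zt icap ocap t F x e | e <- enum (medge H)])).
Proof.
move=> [[h1 h2 h3 h4 h5 h6] ht hF] s9 s8 s4 s7 s8x.
pose J l s' := rmem s' 9 0 = foldl (@min_step R) (-1)
       (flatten [seq constraints zs zt icap ocap t F x e | e <- l]).
apply: wp_weaken (leqnn _) _ (@wp_arcs _ M _ _ J s _ _ h2 _ _ _) => //.
move=> l e s' ul [fn fr] c j1.
have e4 : nmem s' 4 (rk e) = (e \in F) by rewrite fn.
have e7 : nmem s' 7 (rk e) = index_of (zt e) by rewrite fn.
have e8 w : (nmem s' 8 (index_of w) <= 0)%N = blocked zs F w by rewrite fn // s8.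
have e1 : rmem s' 1 (rk e) = t e by rewrite fr.
have e2 : rmem s' 2 (rk e) = icap e by rewrite fr.
have e3 : rmem s' 3 (rk e) = ocap e by rewrite fr.
have x7 : rmem s' 7 (rk e) = x e by rewrite fr.
have x8 : rmem s' 8 (index_of (zt e)) = insum zt x (zt e) by rewrite fr.
have x4 : rmem s' 4 (index_of (zt e)) = insum zt t (zt e) by rewrite fr.
rewrite /J map_rcons -cats1 flatten_cat foldl_cat -j1 [flatten [:: _]]cats0.
rewrite /step_body run_if /constraints.
have -> : beval s' is_fluid = (e \in F) by rewrite /= c e4 lt0b.
case: ifP => eF; last first.
  have [_ -> _] := run_min_cmd thru rate s'.
  by rewrite /= c e1 x7.
rewrite !run_seq; set s1 := run (min_cmd _ _) s'.
have [n1 l1 r1] : [/\ nmem s1 = nmem s', rmem s1 9 0 = min_step (rmem s' 9 0) (ocap e - t e, x e) &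
    forall c i, c != 9%N -> rmem s1 c i = rmem s' c i].
  have [? -> ?] := run_min_cmd (RSub (RRead 3 cur) thru) rate s'.
  by split=> //; rewrite /= c e1 e3 x7.
set s2 := run (min_cmd _ _) s1.
have [n2 l2 r2] : [/\ nmem s2 = nmem s', rmem s2 9 0 = min_step (rmem s1 9 0) (icap e - t e, x e) &
    forall c i, c != 9%N -> rmem s2 c i = rmem s' c i].
  have [nn -> rr] := run_min_cmd (RSub (RRead 2 cur) thru) rate s1; split.
  - by rewrite -n1.
  - by rewrite /= n1 c (r1 2%N) // (r1 1%N) // (r1 7%N) // e1 e2 x7.
  - by move=> a i a9; rewrite rr // r1.
rewrite run_if.
have -> : beval s2 blocked_head = blocked zs F (zt e) by rewrite /= n2 c e7 e8.
case: ifP => b; last by rewrite /= l2 l1.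
have [_ -> _] := run_min_cmd (RSub insum_head (RAdd thru thru)) (RRead 8 (NRead 7 cur)) s2.
by rewrite /= n2 c e7 (r2 4%N) // (r2 8%N) // (r2 1%N) // x4 x8 e1 l2 l1.
Qed.

Lemma push_pass t F s x : holds t F s -> (forall e, rmem s 7 (rk e) = x e) ->
  wp M (for_loop arc_bound push_body) (for_cost arc_bound push_body #|medge H|) s
   (fun s' => frame (for_step push_body) s s' /\
     holds (push t F x (rmem s 9 0)) F s').
Proof.
move=> hs s7; have [[h1 h2 h3 h4 h5 h6] ht hF] := hs.
pose J l s' := forall e,
  rmem s' 1 (rk e) = if e \in l then push t F x (rmem s 9 0) e else t e.
apply: wp_weaken (leqnn _) _ (@wp_arcs _ M _ _ J s _ _ h2 _ _ _) => //.
  move=> s' [f j]; split=> //; split.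
  - exact: layout_frame f _ _ (holds_layout hs).
  - by move=> e; rewrite j mem_enum.
  - by move=> e; rewrite f.1.
move=> l e s' ul [fn fr] c j f.
have el : e \notin l by move: ul; rewrite rcons_uniq => /andP[].
have e4 : nmem s' 4 (rk e) = (e \in F) by rewrite fn.
have x7 : rmem s' 7 (rk e) = x e by rewrite fr.
rewrite /push_body /= c e4 lt0b j (negPf el) x7 fr // mem_rcons inE /push.
case: ifP => eF; rewrite /= /upd /= rk_eq; case: eqP => [->|_] /=; rewrite ?eF ?j //.
Qed.

End Passes.

(** * Time budgets of a round *)

Definition push_cost (e v d : nat) : nat :=
  (cost (Seq (NSet 12 (NConst 0) (NConst 0)) (NSet 13 (NConst 0) (NConst 0))) +
  (for_cost arc_bound move_body e +
  (for_cost node_bound number_body v +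
  (for_cost arc_bound list_body e +
  (ncost (cell 12) + ncost (cell 13) + d +
  (for_cost arc_bound rate_body e +
  (cost (RSet 9 (NConst 0) (RSub RZero ROne)) +
  (for_cost arc_bound step_body e +
   for_cost arc_bound push_body e))))))))%N.

Definition round_cost (e v d : nat) : nat :=
  (cost (Seq (NSet 9 (NConst 0) (NConst 0)) (NSet 11 (NConst 0) (NConst 0))) +
  (for_cost node_bound clear_body v +
  (for_cost arc_bound scan_body e +
  (bcost (NLe (cell 9) (NConst 0)) +
  (for_cost arc_bound saturate_body e +
  (bcost (NLe (NConst 1) (cell 11)) + push_cost e v d))))))%N.

(** The cost is affine in [N], and [D >= 1] absorbs the constant term. *)
Lemma for_cost_le bound body N a D : (0 < D)%N -> (N <= a * D)%N ->
  (for_cost bound body N <= D * for_cost bound body a)%N.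
Proof. by rewrite /for_cost => D0 ND; nia. Qed.

(** The 3 allows for at most two vertices per arc and one more node for [z]. *)
Lemma round_cost_le e v d D : (0 < D)%N -> (e <= D)%N -> (v <= 3 * D)%N ->
  (d <= D)%N -> (round_cost e v d <= D * round_cost 1 3 1)%N.
Proof.
move=> D0 eD vD dD.
have A body : (for_cost arc_bound body e <= D * for_cost arc_bound body 1)%N.
  by rewrite for_cost_le ?mul1n.
have V body := @for_cost_le node_bound body v 3 D D0 vD.
rewrite /round_cost /push_cost /=.
move: (A move_body) (A list_body) (A rate_body) (A step_body) (A push_body).
move: (A scan_body) (A saturate_body) (V number_body) (V clear_body).
repeat match goal with
  |- context [for_cost ?b ?p ?n] => generalize (for_cost b p n)
end.
by move=> *; rewrite !mulnDr; lia.
Qed.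

(** * Correctness and progress of the rounds *)

Section Rounds.


Variables (R : realType) (M : sd_method R) (H : multigraph) (z : mvertex H).
Variables (zs zt : medge H -> mvertex H) (icap ocap : medge H -> R).
Variables (nV : nat) (index_of : mvertex H -> nat).

Hypothesis ends : forall e, mends e = (zs e, zt e).
Hypothesis index_inj : injective index_of.
Hypothesis index_le : forall w, (index_of w <= nV)%N.
Hypothesis index_z : index_of z = nV.
Hypothesis icap_range : forall e, 0 <= icap e <= 1.
Hypothesis ocap_range : forall e, 0 <= ocap e <= 1.
Hypothesis icap_splitter : forall e, zs e != z -> icap e = 1.
Hypothesis ocap_splitter : forall e, zt e != z -> ocap e = 1.
Hypothesis in_degree : forall w, w != z -> #|[set e | zt e == w]| = 2%N.

Implicit Types (s : state R) (t : medge H -> R) (F : {set medge H}).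

Notation holds := (holds zs zt icap ocap nV index_of).
Notation relaxed := (relaxed z zs zt icap ocap).
Notation has_source := (has_source z zs icap).
Notation measure := (measure z zs zt icap ocap).
Notation settled := (settled zs zt ocap).
Notation nE := #|medge H|.

Lemma wp_stat (en em : nexpr) (tl hd r : nat) s (D : digraph) (Q : state R -> Prop) :
  order D = neval s en ->
  [seq (val a.1, val a.2) | a <- darcs D]
    = [seq (nmem s tl k, nmem s hd k) | k <- iota 0 (neval s em)] ->
  has_walk D ->
  (forall s', nmem s' = nmem s ->
     (forall a i, a != r -> rmem s' a i = rmem s a i) ->
     (forall i : 'I_(order D), rmem s' r i = sd_answer M D 0 i) -> Q s') ->
  wp M (Stat en em tl hd r) (ncost en + ncost em + sd_time M D) s Q.
Proof.
move=> oD aD wD Qs; do 2 eexists; split; [exact: leqnn|exact: ExecStat|].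
apply: Qs => //= [a i /negPf ar|i]; first by rewrite /store_row ar.
rewrite /store_row eqxx; case: insubP => [j _ /val_inj -> //|].
by rewrite ltn_ord.
Qed.

Lemma wp_push t F s : holds t F s ->
  relaxed t F -> settled t F -> has_source t F ->
  (forall w, (nmem s 8 (index_of w) <= 0)%N = blocked zs F w) ->
  (forall w, rmem s 4 (index_of w) = insum zt t w) ->
  (forall j, (j <= nV)%N -> rmem s 5 j = 0) ->
  (forall w, rmem s 8 (index_of w) = 0) ->
  wp M push_cmd (push_cost nE nV.+1 (sd M H)) s (fun s' => exists t',
    [/\ relaxed t' F, (measure t' F < measure t F)%N, holds t' F s' &
        nmem s' 10 0 = nmem s 10 0]).
Proof.
move=> hs rel stl src s8 s4 s5 s8x.
pose es := [seq e <- enum (medge H) | moves zs zt icap t F e].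
pose tl := mtail zs zt F; pose hd := mhead zs zt F.
apply: wp_seq; apply: wp_weaken (leqnn _) _ (wp_simple M s _) => // s1 E1.
have f1 : frame (Seq (NSet 12 (NConst 0) (NConst 0)) (NSet 13 (NConst 0) (NConst 0))) s s1.
  by rewrite -E1; apply: run_frame.
have h1 : holds t F s1 by apply: holds_frame f1 _ _ hs.
have n12 : nmem s1 12 0 = 0%N by rewrite -E1.
have n13 : nmem s1 13 0 = 0%N by rewrite -E1.
apply: wp_seq; apply: wp_weaken (leqnn _) _ (move_pass M h1 _ _) => //;
  try by move=> *; rewrite ?f1.1 ?f1.2 ?s8 ?s5.
move=> s2 [f2 [m15 m16 m17 m5]].
have h2 : holds t F s2 by apply: holds_frame f2 _ _ h1.
apply: wp_seq; apply: wp_weaken (leqnn _) _ (number_pass M index_le _ _);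
  [|exact: (layout_nodes (holds_layout h2))|by rewrite f2.1].
set pos := fun i => 0 < rmem s2 5 i.
move=> s3 [f3 [n14 n12']].
have h3 : holds t F s3 by apply: holds_frame f3 _ _ h2.
pose nu w := rank_of pos (index_of w).
apply: wp_seq; apply: wp_weaken (leqnn _) _
  (@list_pass _ M _ index_of s3 (moves zs zt icap t F) tl hd nu
     (layout_arcs (holds_layout h3)) _ n14 _ _ _);
  [|by rewrite f3.1 // f2.1|by move=> e; rewrite f3.1 // m15
   |by move=> e; rewrite f3.1 // m16|by move=> e; rewrite f3.1 // m17].
move=> s4' [f4 arcs4].
have h4 : holds t F s4' by apply: holds_frame f4 _ _ h3.
have esP e : (e \in es) = moves zs zt icap t F e by rewrite mem_filter mem_enum andbT.
have posP j : (j <= nV)%N -> pos j = has (fun e => index_of (tl e) == j) es.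
  by move=> jV; rewrite /pos m5 // ltr0n has_count.
have pos_tl e : e \in es -> pos (index_of (tl e)).
  by move=> ee; rewrite posP //; apply/hasP; exists e => /=.
(* The source is a move, so the digraph has a vertex. *)
have [e0 e0z] : exists e, e \in es.
  case/existsP: src => e /andP[/eqP ez /andP[eF ti]].
  by exists e; rewrite esP /moves eF.
have [n nE'] : exists n, rank_of pos nV.+1 = n.+1.
  have : (nu (tl e0) < rank_of pos nV.+1)%N by apply: rank_of_lt; rewrite ?pos_tl ?ltnS.
  by case: (rank_of pos nV.+1) => // n _; exists n.
have [||||||D [oD aD wD tD pD]] := @walk_digraph _ M H es tl hd n nu.
- by rewrite filter_uniq // enum_uniq.
- by move=> e; rewrite ends /tl /hd /mtail /mhead; case: ifP; rewrite eqxx ?orbT.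
- move=> e; rewrite esP => me.
  have [f mf fe] := moves_head ocap_range icap_splitter in_degree rel stl src me.
  by exists f; rewrite ?esP.
- by move=> e ee; rewrite -nE'; apply: rank_of_lt; rewrite ?pos_tl ?ltnS.
- by move=> e f ee fe /rank_of_inj h; apply: index_inj; apply: h; apply: pos_tl.
- move=> k; rewrite -nE' => /rank_of_surj[j]; rewrite ltnS => jV [pj <-].
  move: pj; rewrite posP // => /hasP[e ee /eqP ej].
  by exists e; rewrite // /nu ej.
have n12s : neval s4' (cell 12) = n.+1 by rewrite /= f4.1 // n12'.
apply: wp_seq; apply: wp_weaken _ _ (wp_stat (Q := fun s5 : state R =>
    [/\ nmem s5 = nmem s4', forall a i, a != 6%N -> rmem s5 a i = rmem s4' a i &
      forall i : 'I_(order D), rmem s5 6 i = sd_answer M D 0 i]) _ _ wD _);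
  [by rewrite leq_add2l| |by rewrite n12s|by rewrite aD /= arcs4|by []].
move=> s5' [N5 R5 A5].
have h5 : holds t F s5'.
  case: h4 => -[? ? ? ? h4i h4o] h4t h4F; split; first split; rewrite ?N5 //.
  - by move=> e; rewrite R5.
  - by move=> e; rewrite R5.
  - by move=> e; rewrite R5.
have [x0 [ex exs ex0] xc] := pD (rmem s5' 6) (fun i => A5 i).
pose dg w : R := (count (fun f => tl f == w) es)%:R.
have a14 w : nmem s5' 14 (index_of w) = nu w by rewrite N5 f4.1 // n14.
have a15 e : nmem s5' 15 (enum_rank e) = index_of (tl e).
  by rewrite N5 f4.1 // f3.1 // m15.
have a17 e : nmem s5' 17 (enum_rank e) = moves zs zt icap t F e.
  by rewrite N5 f4.1 // f3.1 // m17.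
have a5 w : rmem s5' 5 (index_of w) = dg w.
  rewrite R5 // f4.2 // f3.2 // m5 //; congr _%:R.
  by apply: eq_count => f; rewrite inj_eq.
have a8 w : rmem s5' 8 (index_of w) = 0.
  by rewrite R5 // f4.2 // f3.2 // f2.2 // f1.2.
apply: wp_seq.
apply: wp_weaken (leqnn _) _ (rate_pass M index_inj h5 a14 a15 a17 a5 a8).
pose x e := if moves zs zt icap t F e then rmem s5' 6 (nu (tl e)) / dg (tl e) else 0.
move=> s6 [f6 [x7 x8]].
have {}x7 : forall e, rmem s6 7 (enum_rank e) = x e := x7.
have {}x8 : forall w, rmem s6 8 (index_of w) = insum zt x w := x8.
have h6 : holds t F s6 by apply: holds_frame f6 _ _ h5.
apply: wp_seq; apply: wp_weaken (leqnn _) _ (wp_simple M s6 _) => // s7 E7.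
have f7 : frame (RSet 9 (NConst 0) (RSub RZero ROne)) s6 s7.
  by rewrite -E7; apply: run_frame.
have h7 : holds t F s7 by apply: holds_frame f7 _ _ h6.
have b9 : rmem s7 9 0 = -1 by rewrite -E7 /= /upd /= sub0r.
have b8 w : (nmem s7 8 (index_of w) <= 0)%N = blocked zs F w.
  by rewrite f7.1 // f6.1 // N5 f4.1 // f3.1 // f2.1 // f1.1.
have b4 w : rmem s7 4 (index_of w) = insum zt t w.
  by rewrite f7.2 // f6.2 // R5 // f4.2 // f3.2 // f2.2 // f1.2.
have b7 e : rmem s7 7 (enum_rank e) = x e by rewrite f7.2.
have b8x w : rmem s7 8 (index_of w) = insum zt x w by rewrite f7.2.
apply: wp_seq.
apply: wp_weaken (leqnn _) _ (step_pass M h7 b9 b8 b4 b7 b8x).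
move=> s8' [f8 l8].
have h8 : holds t F s8' by apply: holds_frame f8 _ _ h7.
have c7 e : rmem s8' 7 (enum_rank e) = x e by rewrite f8.2.
apply: wp_weaken (leqnn _) _ (push_pass M h8 c7).
move=> s9 [f9 h9]; exists (push t F x (rmem s8' 9 0)).
(* The stored rates are [walk_flow] extended by 0 off the moves, hence a circulation on all arcs. *)
have xE e : moves zs zt icap t F e -> x e = walk_flow es tl nu (rmem s5' 6) e.
  by rewrite /x /walk_flow => ->.
have xN e : ~~ moves zs zt icap t F e -> x e = 0 by rewrite /x => /negPf->.
have xpos e : 0 <= x e.
  by case: (boolP (moves zs zt icap t F e)) => me; [rewrite xE // x0 ?esP | rewrite xN].
have xtail e f : moves zs zt icap t F e -> moves zs zt icap t F f -> tl e = tl f -> x e = x f.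
  by rewrite /x => -> -> ->.
have xsum (P : pred (medge H)) :
    \sum_(e | P e) x e = \sum_(e <- es | P e) walk_flow es tl nu (rmem s5' 6) e.
  rewrite big_filter_cond big_enum_cond /= [LHS]big_mkcond [RHS]big_mkcond /=.
  apply: eq_bigr => e _; case: (P e); rewrite ?andbF // andbT.
  by case: ifP => [/xE|/negbT/xN].
have xcons w : \sum_(e | tl e == w) x e = \sum_(e | hd e == w) x e.
  by rewrite !xsum xc.
have [||l0 le [q [qL q2 qE]]] := foldl_min_step (L :=
  (flatten [seq constraints zs zt icap ocap t F x e | e <- enum (medge H)])).
- by move=> p /flatten_mapP[e _]; apply: constraint_slack.
- have xex : 0 < x ex by rewrite xE // -esP.
  have [q qe q2] := constraint_exists zs zt icap ocap t F xex.
  by exists q => //; apply/flatten_mapP; exists ex; rewrite ?mem_enum.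
rewrite -l8 in l0 le qE.
split=> //.
- apply: push_relaxed => //.
  by move=> e r re r2; apply: le => //; apply/flatten_mapP; exists e; rewrite ?mem_enum.
- by case/flatten_mapP: qL => e _ qe; apply: measure_push qe q2 qE.
by rewrite f9.1 // f8.1 // f7.1 // f6.1 // N5 f4.1 // f3.1 // f2.1 // f1.1.
Qed.

Lemma wp_round t F s : holds t F s -> relaxed t F -> nmem s 10 0 = 0%N ->
  wp M round_cmd (round_cost nE nV.+1 (sd M H)) s (fun s' => exists t' F',
    [/\ relaxed t' F', holds t' F' s' &
        if has_source t F
        then nmem s' 10 0 = 0%N /\ (measure t' F' < measure t F)%N
        else nmem s' 10 0 = 1%N /\ ~~ has_source t' F']).
Proof.
move=> hs rel s10.
apply: wp_seq; apply: wp_weaken (leqnn _) _ (wp_simple M s _) => // s1 E1.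
have f1 : frame (Seq (NSet 9 (NConst 0) (NConst 0)) (NSet 11 (NConst 0) (NConst 0))) s s1.
  by rewrite -E1; apply: run_frame.
have h1 : holds t F s1 by apply: holds_frame f1 _ _ hs.
have n9 : nmem s1 9 0 = 0%N by rewrite -E1.
have n11 : nmem s1 11 0 = 0%N by rewrite -E1.
apply: wp_seq.
apply: wp_weaken (leqnn _) _ (clear_pass M (layout_nodes (holds_layout h1))).
move=> s2 [f2 c2].
have h2 : holds t F s2 by apply: holds_frame f2 _ _ h1.
have b9 : nmem s2 9 0 = 0%N by rewrite f2.1.
have b8 w : nmem s2 8 (index_of w) = 0%N by case: (c2 _ (index_le w)).
have b4 w : rmem s2 4 (index_of w) = 0 by case: (c2 _ (index_le w)).
apply: wp_seq.
apply: wp_weaken (leqnn _) _ (scan_pass M index_inj index_le index_z h2 b9 b8 b4).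
move=> s3 [f3 [c4 c8 c9]].
have h3 : holds t F s3 by apply: holds_frame f3 _ _ h2.
have c11 : nmem s3 11 0 = 0%N by rewrite f3.1 // f2.1.
have c10 : nmem s3 10 0 = 0%N by rewrite f3.1 // f2.1 // f1.1.
apply: wp_if.
have -> : beval s3 (NLe (cell 9) (NConst 0)) = ~~ has_source t F.
  by rewrite /= c9; case: has_source.
case: (boolP (has_source t F)) => src /=; last first.
  apply: wp_weaken _ _ (wp_simple M s3 _) => //.
    by rewrite /for_cost /=; lia.
  move=> s4 E4; exists t, F; split=> //; last by rewrite -E4.
  have f4 : frame (NSet 10 (NConst 0) (NConst 1)) s3 s4 by rewrite -E4; apply: run_frame.
  exact: holds_frame f4 _ _ h3.
apply: wp_seq; apply: wp_weaken (leqnn _) _ (saturate_pass M h3 c11 c4 c8).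
move=> s4 [f4 [h4 d11]].
have d10 : nmem s4 10 0 = 0%N by rewrite f4.1.
apply: wp_if.
have -> : beval s4 (NLe (NConst 1) (cell 11)) = ~~ settled t F.
  by rewrite /= d11; case: settled.
have nbz := source_unblocked src.
case: (boolP (settled t F)) => stl /=; last first.
  apply: wp_weaken _ _ (wp_simple M s4 _) => // _ <-.
  exists t, (saturate zs zt ocap t F); split=> //; first exact: saturate_relaxed.
  split=> //; have lt := potential_saturate rel nbz stl.
  rewrite /measure (negPf stl) addn0.
  (* The doubled potential drops by at least 2 while the bit rises by at most 1. *)
  by apply: leq_ltn_trans (leq_add (leqnn _) (leq_b1 _)) _; lia.
have FE : saturate zs zt ocap t F = F.
  apply/setP => e; rewrite inE; case: (e \in F) => //=.
  by move/forallP: stl => ->.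
rewrite FE in h4.
have d8 w : (nmem s4 8 (index_of w) <= 0)%N = blocked zs F w by rewrite f4.1.
have d4 w : rmem s4 4 (index_of w) = insum zt t w by rewrite f4.2.
have d5 j : (j <= nV)%N -> rmem s4 5 j = 0.
  by move=> jV; rewrite f4.2 // f3.2 //; case: (c2 _ jV).
have d8x w : rmem s4 8 (index_of w) = 0.
  by rewrite f4.2 // f3.2 //; case: (c2 _ (index_le w)).
apply: wp_weaken (leqnn _) _ (wp_push h4 rel stl src d8 d4 d5 d8x).
move=> s5 [t' [rel' lt h5 n10]]; exists t', F; split=> //; split=> //.
by rewrite n10.
Qed.

(** Each test of the outer loop costs 4. The measure bounds the rounds that find a source; the one
    that finds none ends the loop. *)
Lemma wp_rounds m t F s :
  (measure t F < m)%N -> holds t F s -> relaxed t F -> nmem s 10 0 = 0%N ->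
  wp M (While (NLe (cell 10) (NConst 0)) round_cmd)
    (m * (round_cost nE nV.+1 (sd M H) + 4) + 4) s (fun s' => exists t' F',
    [/\ relaxed t' F', holds t' F' s' & ~~ has_source t' F']).
Proof.
elim: m t F s => // m IH t F s; rewrite ltnS => le hs rel s10.
have [k [s1 [kle ex [t' [F' [rel' h1]]]]]] := wp_round hs rel s10.
case: ifP => _ [n10 lt].
  have [k2 [s2 [kle2 ex2 Q]]] := IH t' F' s1 (leq_trans lt le) h1 rel' n10.
  exists (4 + k + k2)%N, s2; split=> //; first by lia.
  by apply: (ExecWhileLoop _ ex ex2); rewrite /= s10.
exists (4 + k + 4)%N, s1; split=> //; first by lia.
  apply: (ExecWhileLoop _ ex); first by rewrite /= s10.
  by apply: ExecWhileStop; rewrite /= n10.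
by exists t', F'.
Qed.

End Rounds.

(** * The contracted network *)

Section Network.

Variables (R : realType) (M : sd_method R) (G : splitter_network).
Variable c : vertex G -> R.
Hypothesis c_capacity : is_capacity c.

Notation nV := #|vertex G|.
Notation nE := #|arc G|.
Notation S := (splitters G).

Definition arc_src (e : medge (Gz G)) : mvertex (Gz G) := contract (src (e : arc G)).
Definition arc_tgt (e : medge (Gz G)) : mvertex (Gz G) := contract (tgt (e : arc G)).
Definition hub : mvertex (Gz G) := None.
Definition end_cap (v : vertex G) : R := if v \in S then 1 else c v.
Definition src_cap (e : medge (Gz G)) : R := end_cap (src (e : arc G)).
Definition tgt_cap (e : medge (Gz G)) : R := end_cap (tgt (e : arc G)).
Definition index_of (w : mvertex (Gz G)) : nat :=
  if w is Some v then enum_rank (val v) else nV.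

Lemma contract_splitter (v : vertex G) : v \in S ->
  exists2 w : {s : vertex G | s \in S}, val w = v & contract v = Some w.
Proof. by move=> vS; exists (Sub v vS) => //; rewrite /contract insubT. Qed.

Lemma contract_eq (v w : vertex G) : w \in S ->
  (contract v == contract w :> mvertex (Gz G)) = (v == w).
Proof.
move=> wS; have [x xw ->] := contract_splitter wS.
rewrite /contract; case: insubP => [y _ yv|vS].
  by rewrite -yv -xw; apply: (inj_eq Some_inj).
by symmetry; apply: contraNF vS => /eqP ->.
Qed.

Lemma contract_hub (v : vertex G) : (contract v == hub) = (v \notin S).
Proof.
case: (boolP (v \in S)) => vS; first by have [x _ ->] := contract_splitter vS.
by rewrite /contract insubN.
Qed.

Lemma vertex_cases (v : vertex G) :
  [|| v \in inputs G, v \in S | v \in outputs G].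
Proof. by have := in_setT v; rewrite -(vertex_cover G) !inE orbA. Qed.

Lemma src_cases (e : arc G) : (src e \in inputs G) || (src e \in S).
Proof.
have /or3P[->//|->|/output_degree[_ /eqP]] := vertex_cases (src e); first by rewrite orbT.
by rewrite cards_eq0 => /eqP/setP/(_ e); rewrite !inE eqxx.
Qed.

Lemma tgt_cases (e : arc G) : (tgt e \in S) || (tgt e \in outputs G).
Proof.
have /or3P[/input_degree[_ /eqP]|->//|->] := vertex_cases (tgt e); last by rewrite orbT.
by rewrite cards_eq0 => /eqP/setP/(_ e); rewrite !inE eqxx.
Qed.

Lemma end_cap_range v : 0 <= end_cap v <= 1.
Proof.
rewrite /end_cap; case: ifP => vS; first by rewrite ler01 lexx.
by apply: c_capacity; have := vertex_cases v; rewrite vS inE.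
Qed.

Lemma src_cap_splitter e : arc_src e != hub -> src_cap e = 1.
Proof. by rewrite contract_hub negbK /src_cap /end_cap => ->. Qed.

Lemma tgt_cap_splitter e : arc_tgt e != hub -> tgt_cap e = 1.
Proof. by rewrite contract_hub negbK /tgt_cap /end_cap => ->. Qed.

Lemma contracted_in_degree w : w != hub -> #|[set e | arc_tgt e == w]| = 2%N.
Proof.
case: w => // -[v vS] _; have [d _] := splitter_degree vS.
rewrite -d; apply: eq_card => e; rewrite !inE -(contract_eq _ vS).
by rewrite /arc_tgt; congr (_ == _); rewrite /contract insubT.
Qed.

Lemma index_of_inj : injective index_of.
Proof.
move=> [v|] [w|] //=.
- by move/ord_inj/enum_rank_inj/val_inj ->.
- by move=> h; have := ltn_ord (enum_rank (val v)); rewrite h ltnn.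
- by move=> h; have := ltn_ord (enum_rank (val w)); rewrite -h ltnn.
Qed.

Lemma index_of_le w : (index_of w <= nV)%N.
Proof. by case: w => //= v; apply: ltnW. Qed.

Notation relaxed := (relaxed hub arc_src arc_tgt src_cap tgt_cap).

(** Absence of a source is the missing input rule: a fluid input arc is no longer below its
    capacity. *)
Lemma relaxed_steady t F : relaxed t F ->
  ~~ has_source hub arc_src src_cap t F -> steady_state c t F.
Proof.
move=> r ns; split.
- move=> e; rewrite (rel_ge0 r); apply: le_trans (rel_icap r e) _.
  by case/andP: (end_cap_range (src (e : arc G))).
- move=> i e iI oe; have : e \in out_arcs i by rewrite oe set11.
  rewrite inE => /eqP ei.
  have iS : i \in S = false by apply: (disjointFr (inputs_splitters G)).
  have ci : src_cap e = c i by rewrite /src_cap /end_cap ei iS.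
  split; first by rewrite -ci (rel_icap r).
  move=> eF; apply/eqP; rewrite -ci eq_le (rel_icap r) leNgt.
  apply: contraNN ns => te; apply/existsP; exists e.
  by rewrite /active eF te contract_hub ei iS.
- move=> o e oO ie; have : e \in in_arcs o by rewrite ie set11.
  rewrite inE => /eqP eo.
  have oS : o \in S = false by apply: (disjointFl (splitters_outputs G)).
  have co : tgt_cap e = c o by rewrite /tgt_cap /end_cap eo oS.
  split; first by rewrite -co (rel_ocap r).
  move=> eF; rewrite -co; apply: (rel_output r) => //.
  by apply/eqP; rewrite contract_hub eo oS.
- move=> s sS; have nz : contract s != hub by rewrite contract_hub negbK.
  have := rel_conserve r nz; rewrite /arc_src /arc_tgt.
  rewrite (eq_bigl [in in_arcs s]); last by move=> e; rewrite inE contract_eq.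
  by rewrite [RHS](eq_bigl [in out_arcs s]) // => e; rewrite inE contract_eq.
- move=> s e1 e2 sS E; have : e1 \in in_arcs s by rewrite E set21.
  have : e2 \in in_arcs s by rewrite E set22.
  rewrite !inE => /eqP h2 /eqP h1; apply: (rel_saturated_in r).
    by rewrite /arc_tgt h1 h2.
  by rewrite contract_hub h1 negbK.
- move=> s e1 e2 sS E; have : e1 \in out_arcs s by rewrite E set21.
  have : e2 \in out_arcs s by rewrite E set22.
  rewrite !inE => /eqP h2 /eqP h1; apply: (rel_fluid_out r).
    by rewrite /arc_src h1 h2.
  by rewrite contract_hub h1 negbK.
move=> e f ef; apply: (rel_saturated_fluid r); first by rewrite /arc_tgt ef.
rewrite contract_hub negbK.
(* The common vertex of consecutive arcs is a splitter: otherwise it would be both an input and an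
   output. *)
have := src_cases f; have := tgt_cases e; rewrite ef => /orP[->//|fO] /orP[fI|->//].
by have := disjointFr (inputs_outputs G) fI; rewrite fO.
Qed.

(** * Counting arcs and vertices by degrees *)

Lemma card_fibers (f : arc G -> vertex G) (X : {set vertex G}) d :
  (forall v, v \in X -> #|[set e | f e == v]| = d) ->
  #|[set e | f e \in X]| = (#|X| * d)%N.
Proof.
move=> h; rewrite -sum1dep_card (partition_big f [in X]) //=.
rewrite -sum_nat_const; apply: eq_bigr => v vX; rewrite -(h v vX) -sum1dep_card.
by apply: eq_bigl => e; case: eqP => [->|]; rewrite ?andbF // vX.
Qed.

Lemma card_out_splitters : #|[set e : arc G | src e \in S]| = (#|S| * 2)%N.
Proof. by apply: card_fibers => v /splitter_degree[]. Qed.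

Lemma card_in_splitters : #|[set e : arc G | tgt e \in S]| = (#|S| * 2)%N.
Proof. by apply: card_fibers => v /splitter_degree[]. Qed.

Lemma card_arcs_inputs : nE = (#|inputs G| + #|S| * 2)%N.
Proof.
have := @card_fibers (@src G) (inputs G) 1 (fun v h => (input_degree h).1).
rewrite muln1 => <-; rewrite -card_out_splitters -cardsUI.
rewrite (_ : _ :|: _ = setT) ?cardsT; last by apply/setP => e; rewrite !inE src_cases.
rewrite (_ : _ :&: _ = set0) ?cards0 ?addn0 //; apply/setP => e; rewrite !inE.
by apply/negP => /andP[eI]; rewrite (disjointFr (inputs_splitters G)).
Qed.

Lemma card_arcs_outputs : nE = (#|S| * 2 + #|outputs G|)%N.
Proof.
have := @card_fibers (@tgt G) (outputs G) 1 (fun v h => (output_degree h).1).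
rewrite muln1 => <-; rewrite -card_in_splitters -cardsUI.
rewrite (_ : _ :|: _ = setT) ?cardsT; last by apply/setP => e; rewrite !inE tgt_cases.
rewrite (_ : _ :&: _ = set0) ?cards0 ?addn0 //; apply/setP => e; rewrite !inE.
by apply/negP => /andP[eI]; rewrite (disjointFr (splitters_outputs G)).
Qed.

Lemma card_vertices : (nV <= 2 * nE)%N.
Proof.
have : (nV <= #|inputs G| + #|S| + #|outputs G|)%N.
  rewrite -cardsT -(vertex_cover G); apply: leq_trans (leq_card_setU _ _) _.
  by rewrite leq_add2r leq_card_setU.
by have := card_arcs_inputs; have := card_arcs_outputs; lia.
Qed.

Lemma card_indirect :
  (#|[set e | ~~ direct hub arc_src arc_tgt e]| <= #|S| * 4)%N.
Proof.
have -> : [set e | ~~ direct hub arc_src arc_tgt e] =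
    [set e : arc G | src e \in S] :|: [set e : arc G | tgt e \in S].
  by apply/setP => e; rewrite !inE /direct !contract_hub negb_and !negbK.
apply: leq_trans (leq_card_setU _ _) _.
by rewrite card_out_splitters card_in_splitters; lia.
Qed.

(** All arcs, oriented as in [G], form a digraph without sinks: if an output exists, the two counts
    of arcs give as many inputs as outputs, so some arc leaves [hub]. The method has to read this
    digraph. *)
Lemma arcs_le_sd : (0 < #|S|)%N -> (nE <= sd M (Gz G))%N.
Proof.
move=> S0; pose es := enum (medge (Gz G)).
pose ws := undup (map arc_src es).
have mem_ws (e : medge (Gz G)) : arc_src e \in ws.
  by rewrite mem_undup map_f // mem_enum.
have Ege0 : (0 < nE)%N by rewrite card_arcs_inputs; lia.
have /card_gt0P[e0 _] := Ege0.
have [n nE'] : exists n, size ws = n.+1.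
  by exists (size ws).-1; rewrite prednK // -has_predT; apply/hasP; exists (arc_src e0).
have [||||||D [oD aD wD tD _]] :=
  @walk_digraph R M (Gz G) es arc_src arc_tgt n (index^~ ws).
- exact: enum_uniq.
- by move=> e; rewrite eqxx.
- move=> e _; suff [f fe] : exists f, arc_src f = arc_tgt e.
    by exists f; rewrite ?mem_enum.
  case: (boolP (tgt (e : arc G) \in S)) => eS.
    have [_ /eqP/cards2P[f [g [_ E]]]] := splitter_degree eS.
    have : f \in out_arcs (tgt (e : arc G)) by rewrite /out_arcs E set21.
    by rewrite inE => /eqP fe; exists f; rewrite /arc_src fe.
  have oO : tgt (e : arc G) \in outputs G by have := tgt_cases e; rewrite (negPf eS).
  have /card_gt0P[i iI] : (0 < #|inputs G|)%N.
    have : (0 < #|outputs G|)%N by apply/card_gt0P; exists (tgt (e : arc G)).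
    by have := card_arcs_inputs; have := card_arcs_outputs; lia.
  have [/eqP/cards1P[f E] _] := input_degree iI.
  have : f \in [set e | src e == i] by rewrite E set11.
  rewrite inE => /eqP fi; exists f.
  have /eqP -> : arc_tgt e == hub by rewrite contract_hub.
  by apply/eqP; rewrite contract_hub fi (disjointFr (inputs_splitters G)).
- by move=> e _; rewrite -nE' index_mem.
- by move=> e f _ _ /(congr1 (nth hub ws)); rewrite !nth_index.
- move=> k; rewrite -nE' => kw.
  have : nth hub ws k \in ws by rewrite mem_nth.
  rewrite mem_undup => /mapP[e ee ek]; exists e => //.
  by rewrite -ek index_uniq // undup_uniq.
apply: leq_trans tD; apply: leq_trans (sd_reads M wD).
have := congr1 size aD; rewrite size_map [RHS]size_map -cardE => ->.
exact: leq_addl.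
Qed.

Notation rk e := (nat_of_ord (enum_rank e)).

(** The disjunction reflects that the memory holds no capacity for a splitter, where the program
    uses 1. *)
Lemma run_contract_end ends cn cp (s : state R) e (v : vertex G) :
  nmem s 5 0 = e -> nmem s ends e = rk v -> nmem s 3 (rk v) = vertex_kind v ->
  nmem s 0 0 = nV -> rmem s 0 (rk v) = end_cap v \/ v \in S ->
  cn \notin [:: 0; 3; 5; ends]%N ->
  run (contract_end ends cn cp) s =
  State (upd (nmem s) cn e (index_of (contract v))) (upd (rmem s) cp e (end_cap v)).
Proof.
rewrite !inE !negb_or => s5 se s3 s0 sc /and4P[/negPf c0 _ /negPf c5 /negPf ce].
have d5 : (5%N == cn) = false by rewrite eq_sym.
have de : (ends == cn) = false by rewrite eq_sym.
rewrite /contract_end /= s5 se s3 /vertex_kind.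
have kind : (if v \in inputs G then 0 else if v \in S then 1 else 2)%N =
    (if v \in S then 1 else if v \in inputs G then 0 else 2)%N.
  by case: ifP => // vI; rewrite (disjointFr (inputs_splitters G) vI).
rewrite kind; case: (boolP (v \in S)) sc => vS sc /=.
  have [x xv ->] := contract_splitter vS.
  by rewrite /= xv /end_cap vS /upd d5 /= s5.
have {sc} sc : rmem s 0 (rk v) = end_cap v by case: sc.
have -> : contract v = None by rewrite /contract insubN.
case: (v \in inputs G) => /=;
  by rewrite /upd d5 de /= s5 s0 se sc.
Qed.

Notation start_t := (initial_t hub arc_src arc_tgt src_cap tgt_cap).
Notation start_F := (initial_F hub arc_src arc_tgt src_cap tgt_cap).
Notation holds := (holds arc_src arc_tgt src_cap tgt_cap nV index_of).

Lemma init_pass : let s := initial_state c in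
  wp M (for_loop arc_bound init_body) (for_cost arc_bound init_body nE) s
   (fun s' => frame (for_step init_body) s s' /\ holds start_t start_F s').
Proof.
move=> s; pose t := start_t; pose F := start_F.
pose J (l : seq (medge (Gz G))) s' :=
  (forall e, e \in l -> [/\ nmem s' 6 (rk e) = index_of (arc_src e),
     nmem s' 7 (rk e) = index_of (arc_tgt e), rmem s' 2 (rk e) = src_cap e &
     rmem s' 3 (rk e) = tgt_cap e]) /\
  forall e, rmem s' 1 (rk e) = (if e \in l then t e else 0) /\
     nmem s' 4 (rk e) = ((e \in l) && (e \in F)).
have rk_nth (T : finType) (x : T) U (g : T -> U) u : nth u (map g (enum T)) (rk x) = g x.
  by rewrite (nth_map x) ?nth_enum_rank // -cardE.
apply: wp_weaken (leqnn _) _ (@wp_arcs _ M _ _ J s _ _ _ _ _ _) => //.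
- move=> s' [f [j1 j2]]; split=> //; split; first split.
  + by rewrite f.1.
  + by rewrite f.1.
  + by move=> e; case: (j1 e); rewrite ?mem_enum.
  + by move=> e; case: (j1 e); rewrite ?mem_enum.
  + by move=> e; case: (j1 e); rewrite ?mem_enum.
  + by move=> e; case: (j1 e); rewrite ?mem_enum.
  + by move=> e; case: (j2 e) => -> _; rewrite mem_enum.
  + by move=> e; case: (j2 e) => _ ->; rewrite mem_enum.
- by split=> // e; rewrite /= !nth_nil.
move=> l e s' ul [fn fr] e5 [j1 j2].
have el : e \notin l by move: ul; rewrite rcons_uniq => /andP[].
have [t_e f_e] := j2 e; rewrite (negPf el) /= in t_e f_e.
have e1 : nmem s' 1 (rk e) = rk (src (e : arc G)) by rewrite fn //= rk_nth.
have e2 : nmem s' 2 (rk e) = rk (tgt (e : arc G)) by rewrite fn //= rk_nth.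
have e3 (v : vertex G) : nmem s' 3 (rk v) = vertex_kind v by rewrite fn //= rk_nth.
have e0 : nmem s' 0 0 = nV by rewrite fn.
have r0 (v : vertex G) : rmem s' 0 (rk v) = end_cap v \/ v \in S.
  case: (boolP (v \in S)) => vS; [by right | left].
  rewrite fr //= [LHS]rk_nth /end_cap (negPf vS) inE.
  by have := vertex_cases v; rewrite (negPf vS) => ->.
rewrite /init_body run_seq (run_contract_end _ e5 e1 (e3 _) e0 (r0 _)) //.
set s1 := State _ _.
have e5' : nmem s1 5 0 = rk e by [].
have e2' : nmem s1 2 (rk e) = rk (tgt (e : arc G)) by [].
have e3' (v : vertex G) : nmem s1 3 (rk v) = vertex_kind v by apply: e3.
have e0' : nmem s1 0 0 = nV by [].
have r0' (v : vertex G) : rmem s1 0 (rk v) = end_cap v \/ v \in S by apply: r0.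
rewrite run_seq (run_contract_end _ e5' e2' (e3' _) e0' (r0' _)) //.
have hub_index w : (nV <= index_of w)%N = (w == hub).
  exact: (index_geq index_of_inj index_of_le).
rewrite /= /upd /= e5 !eqxx /= e0.
rewrite -[contract (src _)]/(arc_src e) -[contract (tgt _)]/(arc_tgt e) !hub_index.
rewrite -[end_cap (src _)]/(src_cap e) -[end_cap (tgt _)]/(tgt_cap e).
have in_l f : f \in rcons l e -> f = e \/ f != e /\ f \in l.
  rewrite mem_rcons inE => /orP[/eqP|fl]; [by left|right; split=> //].
  by apply: contraTneq fl => ->.
have rkE (f : medge (Gz G)) : (rk f == rk e) = (f == e) by apply: rk_eq.
have tE : t e = if (arc_src e == hub) && (arc_tgt e == hub) then
    (if tgt_cap e <= src_cap e then tgt_cap e else src_cap e) else 0.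
  rewrite /t /initial_t /direct; case: ifP => // _; case: ifP => h.
    by rewrite min_r.
  by rewrite min_l // ltW // ltNge h.
have FE : (e \in F) =
    ~~ ((arc_src e == hub) && (arc_tgt e == hub) && (tgt_cap e <= src_cap e)).
  by rewrite inE /direct ltNge; case: ((_ == _) && _).
split=> f.
  case/in_l => [->|[/negPf fe fl]].
    by case: ifP => // _; [case: ifP => //|]; rewrite /= !eqxx.
  have [? ? ? ?] := j1 f fl.
  by case: ifP => // _; [case: ifP => //|]; rewrite /= ?rkE ?fe.
rewrite mem_rcons inE; have [jt jf] := j2 f.
case: ifP => hh; [case: ifP => le|]; rewrite /= rkE;
  by case: eqP => [->|_] //=; rewrite ?t_e ?f_e tE FE ?hh ?le.
Qed.

End Network.

Theorem theorem1 :
  exists (A : cmd) (C : nat),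
    forall (R : realType) (M : sd_method R) (G : splitter_network)
           (c : vertex G -> R),
      is_capacity c ->
      exists (k : nat) (s : state R),
        [/\ exec M A (initial_state c) k s,
            steady_state c (result_throughput s) (result_fluid G s)
          & (0 < #|splitters G|)%N ->
            (k <= C * (#|splitters G| ^ 2 + #|splitters G| * sd M (Gz G)))%N].
Proof.
exists algorithm, (for_cost arc_bound init_body 1 +
  26 * (round_cost 1 3 1 + 4) + 4)%N => R M G c hc.
set s0 := initial_state c.
(* At most [4 * #|S|] arcs touch a splitter, so the initial measure is at most [6 * (#|S| * 4) + 1],
   strictly below [m]. *)
pose m := (6 * (#|splitters G| * 4) + 2)%N.
pose K := (for_cost arc_bound init_body #|arc G| +
  (m * (round_cost #|arc G| #|vertex G|.+1 (sd M (Gz G)) + 4) + 4))%N.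
have [k [s [kK ex [t [F [rel hs nsrc]]]]]] : wp M algorithm K s0
    (fun s => exists t F, [/\
      relaxed (hub G) (@arc_src G) (@arc_tgt G) (src_cap c) (tgt_cap c) t F,
      holds (@arc_src G) (@arc_tgt G) (src_cap c) (tgt_cap c) #|vertex G|
        (@index_of G) t F s &
      ~~ has_source (hub G) (@arc_src G) (src_cap c) t F]).
  apply: wp_seq; apply: wp_weaken (leqnn _) _ (init_pass M c) => s1 [f1 h1].
  apply: wp_rounds h1 _ _ => //.
  - exact: index_of_inj.
  - exact: index_of_le.
  - by move=> e; apply: end_cap_range.
  - by move=> e; apply: end_cap_range.
  - exact: src_cap_splitter.
  - exact: tgt_cap_splitter.
  - exact: contracted_in_degree.
  - by rewrite /m addn2 ltnS -addn1; apply: measure_le; apply: card_indirect.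
  - by apply: initial_relaxed => e; apply: end_cap_range.
  - by rewrite f1.1 //= nth_nil.
exists k, s; split=> //.
  have -> : result_throughput s = t by apply/boolp.funext => e; apply: holds_t hs e.
  have -> : result_fluid G s = F.
    by apply/setP => e; rewrite inE (holds_F hs e); case: (e \in F).
  exact: relaxed_steady.
move=> S0; have ED := arcs_le_sd M S0.
have E0 : (0 < #|arc G|)%N by rewrite card_arcs_inputs; lia.
have VE := card_vertices G.
set D := sd M (Gz G) in ED K kK *; have D0 : (0 < D)%N := leq_trans E0 ED.
have h1 : (for_cost arc_bound init_body #|arc G| <= D * for_cost arc_bound init_body 1)%N.
  by rewrite for_cost_le ?mul1n.
have h2 : (round_cost #|arc G| #|vertex G|.+1 D <= D * round_cost 1 3 1)%N.
  by apply: round_cost_le => //; lia.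
apply: leq_trans kK _; rewrite /K /m.
move: h1 h2; move: (for_cost _ _ 1) (round_cost 1 3 1) => a b.
move: (for_cost _ _ _) (round_cost _ _ _) => x y xa yb.
move: (#|splitters G|) S0 => N N0.
have yD : (y + 4 <= D * (b + 4))%N by nia.
(* The constant 26 comes from [24 * N + 2 <= 26 * N] for [N >= 1]. *)
have hm : ((6 * (N * 4) + 2) * (y + 4) <= 26 * N * (D * (b + 4)))%N.
  by apply: leq_mul => //; lia.
have ND : (0 < N * D)%N by rewrite muln_gt0 N0.
have hx : (x <= N * D * a)%N by apply: leq_trans xa _; nia.
apply: (@leq_trans ((a + 26 * (b + 4) + 4) * (N * D))).
  by nia.
by rewrite leq_mul2l leq_addl orbT.
Qed.
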